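(* Let $G$ be a compact connected metric graph of total length $L$, and let $\{\psi_j\}_{j\ge1}$ be an orthonormal basis of real-valued eigenfunctions of the Kirchhoff-Neumann Laplacian on $G$, ordered so that the eigenvalues $\lambda_j=\sigma_j^2$ ($\sigma_j\ge 0$) are nondecreasing. Let $\mathbf e$ be an edge of $G$ parametrized by $x\in[0,a]$, and write the restriction of $\psi_j$ to $\mathbf e$ as $\psi_j|_{\mathbf e}(x)=b_j(\mathbf e)\cos(\sigma_jx+\phi_j)$ with $b_j(\mathbf e)\ge0$. Then $$\lim_{N\to\infty}\frac1N\sum_{j=1}^Nb_j(\mathbf e)^2=\frac2L.$$
   Context: A compact metric graph $G$ consists of finitely many vertices and finitely many edges, each edge identified with an interval of finite positive length; $L$ is the sum of the edge lengths. The Kirchhoff-Neumann Laplacian $-\Delta$ is the self-adjoint operator on $L^2(G)$ associated to the quadratic form $\|u'\|^2$ with domain $H^1(G)$. It acts as $-d^2/dx^2$ on each edge, on functions that are continuous on $G$ and whose outward derivatives sum to zero at each vertex. For $\lambda_j>0$ the amplitude $b_j(\mathbf e)$ is uniquely determined by $\psi_j$ (and is $0$ if $\psi_j$ vanishes on $\mathbf e$); for $\lambda_1=0$ fix any choice of $b_1(\mathbf e)\ge 0$ and $\phi_1$ satisfying the identity. *)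

(* Defs.v *)
From HB Require Import structures.
From mathcomp Require Import all_boot all_order all_algebra.
From mathcomp Require Import all_classical all_reals all_analysis.

Set Implicit Arguments.
Unset Strict Implicit.
Unset Printing Implicit Defensive.

Import Order.TTheory GRing.Theory Num.Theory.
Import numFieldNormedType.Exports.

Local Open Scope classical_set_scope.
Local Open Scope ring_scope.

(* The edge [e] is the interval [0, len e], glued to the vertex [src e] at 0
   and to [tgt e] at [len e]. Loops ([src e = tgt e]) and parallel edges are
   allowed. *)
Record metricGraph (R : realType) := MetricGraph {
  vertex : finType;
  edge : finType;
  src : edge -> vertex;
  tgt : edge -> vertex;
  len : edge -> R;
  len_gt0 : forall e, 0 < len e }.

Definition total_length (R : realType) (G : metricGraph R) : R :=
  \sum_(e : edge G) len e.

Definition adjacent (R : realType) (G : metricGraph R) : rel (vertex G) :=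
  fun v w => [exists e : edge G,
    ((src e == v) && (tgt e == w)) || ((src e == w) && (tgt e == v))].

Definition connected_graph (R : realType) (G : metricGraph R) : Prop :=
  forall v w : vertex G, connect (@adjacent R G) v w.

(* A real function on the graph is given edge by edge; the values [u e x] for
   [x] outside [0, len e] are irrelevant in everything below. *)
Definition graph_fun (R : realType) (G : metricGraph R) := edge G -> R -> R.

Definition inL2 (R : realType) (G : metricGraph R) (u : graph_fun G) : Prop :=
  forall e : edge G,
    (u e \_ `[0, len e]) \in Lfun (@lebesgue_measure R) 2%:E.

Definition ip (R : realType) (G : metricGraph R) (u v : graph_fun G) : R :=
  \sum_(e : edge G) \int[@lebesgue_measure R]_(x in `[0, len e]) (u e x * v e x).

Definition continuous_at_vertices (R : realType) (G : metricGraph R)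
    (u : graph_fun G) : Prop :=
  exists uV : vertex G -> R,
    forall e : edge G, u e 0 = uV (src e) /\ u e (len e) = uV (tgt e).

(* [u] belongs to H^1(G) and [du] is its derivative: on every edge [u] is
   absolutely continuous (the indefinite integral of [du]) with [du] square
   integrable, and [u] is continuous at the vertices. The function [du] is
   determined by [u] up to a null set. *)
Definition H1_deriv (R : realType) (G : metricGraph R)
    (u du : graph_fun G) : Prop :=
  [/\ inL2 du,
      forall (e : edge G) (x : R), 0 <= x <= len e ->
        u e x = u e 0 + \int[@lebesgue_measure R]_(t in `[0, x]) du e t
    & continuous_at_vertices u].

(* [kn_laplacian u f]: [u] lies in the domain of the Kirchhoff-Neumann
   Laplacian and [-Delta u = f], where [-Delta] is the operator associated to
   the quadratic form [ip u' u'] with domain H^1(G): [u] is in the form domain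
   and the polarised form satisfies [ip u' v' = ip f v] for all [v] in H^1(G).
   Vanishing of the sums of outward derivatives is encoded by testing against
   [v] that do not vanish at the vertices. *)
Definition kn_laplacian (R : realType) (G : metricGraph R)
    (u f : graph_fun G) : Prop :=
  inL2 f /\
  exists2 du : graph_fun G, H1_deriv u du &
    forall v dv : graph_fun G, H1_deriv v dv -> ip du dv = ip f v.

Definition eigenfunction (R : realType) (G : metricGraph R)
    (lambda : R) (u : graph_fun G) : Prop :=
  kn_laplacian u (fun e x => lambda * u e x) /\ ip u u != 0.

(* The second condition is convergence in L^2 of the Fourier expansion of [f],
   expressed through the squared norm of the remainder. *)
Definition orthonormal_basis (R : realType) (G : metricGraph R)
    (psi : nat -> graph_fun G) : Prop :=
  [/\ forall j, inL2 (psi j),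
      forall i j, ip (psi i) (psi j) = (i == j)%:R
    & forall f : graph_fun G, inL2 f ->
        let rem (n : nat) : graph_fun G :=
          fun e x => f e x - \sum_(j < n) ip f (psi j) * psi j e x in
        ip (rem n) (rem n) @[n --> \oo] --> (0 : R)].

(* Main.v *)
Require Import Defs.
From HB Require Import structures.
From mathcomp Require Import all_boot all_order all_algebra.
From mathcomp Require Import all_classical all_reals all_analysis.
From mathcomp Require Import measurable_realfun ring lra.
Import Order.TTheory GRing.Theory Num.Theory.
Import numFieldNormedType.Exports.
Local Open Scope classical_set_scope.
Local Open Scope ring_scope.

(* Write [m_j(e)] for the integral of [psi_j ^ 2] over the edge [e]; the [m_j(e)]
   add up to 1 over the edges. The weak eigenvalue equation forces
   [psi_j = A cos (sigma_j x) + B sin (sigma_j x)] on every edge, so that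
   [m_j(e) = b_j(e) ^ 2 * len e / 2 + O(1 / sigma_j)], and it suffices that the
   averages of [m_j(e)] tend to [len e / L].
   Upper bound on the number of eigenvalues: if [sigma_j < w] for [j < n] and [n]
   exceeds the number of points of a grid of mesh less than [pi / w], then some
   combination of the first [n] eigenfunctions vanishes on the grid, against the
   Poincare inequality. Hence [n <= w * L / pi + O(1)].
   Lower bound on the mass: expand the first [M] Neumann modes of the interval
   [e], of frequencies up to [(1 - eps) * sigma_N], in the basis [psi]. By Parseval
   the squared coefficients add up to [M]; those with [j < N] contribute at most
   the sum of the [m_j(e)] by Bessel, and those with [j >= N] contribute [O(1)] by
   the frequency gap. With the first bound, the average of [m_j(e)] over [j < N]
   is at least [len e / L - o(1)]. These lower bounds add up to the total mass 1,
   so all of them are sharp. *)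

(** * Calculus of sinusoids *)

Section calculus.
Context {R : realType}.
Notation mu := (@lebesgue_measure R).
Implicit Types (f F u : R -> R) (p q x : R).

Lemma continuous_integrable_segment f p q :
  {within `[p, q], continuous f} -> mu.-integrable `[p, q] (EFin \o f).
Proof.
by move=> cf; apply: continuous_compact_integrable => //; exact: segment_compact.
Qed.

Lemma integrable_segment f p q :
  continuous f -> mu.-integrable `[p, q] (EFin \o f).
Proof.
move=> cf; apply: continuous_integrable_segment.
exact: continuous_subspaceT.
Qed.

Lemma Rintegral_FTC F f p q : p <= q ->
  {within `[p, q], continuous f} ->
  (forall x, x \in `[p, q] -> is_derive x 1 F (f x)) ->
  \int[mu]_(x in `[p, q]) f x = F q - F p.
Proof.
rewrite le_eqVlt => /predU1P[->|pq] cf dF.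
  by rewrite set_itv1 Rintegral_set1 subrr.
have cF x : x \in `[p, q] -> {for x, continuous F}.
  move=> xpq; apply/differentiable_continuous/derivable1_diffP.
  by have [] := dF _ xpq.
rewrite /Rintegral (@continuous_FTC2 _ f F)//.
- split=> [x xpq||].
  + by have [] := dF _ (subset_itv_oo_cc xpq).
  + by apply: cvg_at_right_filter; apply: cF; rewrite in_itv/= lexx ltW.
  + by apply: cvg_at_left_filter; apply: cF; rewrite in_itv/= lexx ltW.
- move=> x xpq; rewrite derive1E.
  by have [_ ->] := dF _ (subset_itv_oo_cc xpq).
Qed.

Lemma Rintegral_FTC_continuous F f p q : p <= q -> continuous f ->
  (forall x, is_derive x 1 F (f x)) ->
  \int[mu]_(x in `[p, q]) f x = F q - F p.
Proof.
by move=> pq cf dF; apply: Rintegral_FTC => //; exact: continuous_subspaceT.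
Qed.

Lemma is_derive_continuous F f x : is_derive x 1 F (f x) -> {for x, continuous F}.
Proof. by case=> dF _; apply/differentiable_continuous/derivable1_diffP. Qed.

(** Coefficients instead of amplitude and phase make the family closed under differentiation, with
    [(A, B)] sent to [(s * B, - (s * A))]; for [s = 0] only constants remain. *)
Definition sinusoid (A B s x : R) : R := A * cos (s * x) + B * sin (s * x).

Lemma is_derive_sinusoid A B s x :
  is_derive x 1 (sinusoid A B s) (sinusoid (s * B) (- (s * A)) s x).
Proof.
rewrite /sinusoid.
have d : is_derive x 1 (fun y => s * y) s.
  by apply: is_derive_eq; rewrite /GRing.scale/= mulr1.
have dc := is_derive1_comp (is_derive_cos (s * x)) d.
have ds := is_derive1_comp (is_derive_sin (s * x)) d.
apply: is_derive_eq (is_deriveD (is_deriveZ A dc) (is_deriveZ B ds)) _.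
by rewrite /GRing.scale/=; ring.
Qed.

Lemma continuous_sinusoid A B s : continuous (sinusoid A B s).
Proof. by move=> x; exact: is_derive_continuous (is_derive_sinusoid A B s x). Qed.


Lemma is_derive_mul f g (df dg x : R) :
  is_derive x 1 f df -> is_derive x 1 g dg ->
  is_derive x 1 (fun y => f y * g y) (df * g x + f x * dg).
Proof.
move=> hf hg; apply: is_derive_eq (is_deriveM hf hg) _.
by rewrite /GRing.scale/=; ring.
Qed.

Lemma is_derive_add f g (df dg x : R) :
  is_derive x 1 f df -> is_derive x 1 g dg ->
  is_derive x 1 (fun y => f y + g y) (df + dg).
Proof. by move=> hf hg; exact: is_deriveD. Qed.

Lemma is_derive_scale f (c df x : R) :
  is_derive x 1 f df -> is_derive x 1 (fun y => c * f y) (c * df).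
Proof. by move=> hf; exact: (is_deriveZ c hf). Qed.

Lemma continuous_mul f g : continuous f -> continuous g ->
  continuous (fun x => f x * g x).
Proof. by move=> cf cg x; apply: cvgM; [exact: cf|exact: cg]. Qed.

(* Green's identity for [cos (t x)], whose derivative vanishes at [0] and [l]. *)
Lemma Rintegral_cos_sinusoid A B s t l : 0 <= l -> sin (t * l) = 0 ->
  (s ^+ 2 - t ^+ 2) * \int[mu]_(x in `[0, l]) (cos (t * x) * sinusoid A B s x) =
  s * B - cos (t * l) * sinusoid (s * B) (- (s * A)) s l.
Proof.
move=> l0 stl.
have du x := is_derive_sinusoid A B s x.
have ddu x := is_derive_sinusoid (s * B) (- (s * A)) s x.
have cE x : sinusoid 1 0 t x = cos (t * x) by rewrite /sinusoid mul1r mul0r addr0.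
have dcE x : sinusoid (t * 0) (- (t * 1)) t x = - t * sin (t * x).
  by rewrite /sinusoid; ring.
have dc x := is_derive_sinusoid 1 0 t x.
have ddc x := is_derive_sinusoid (t * 0) (- (t * 1)) t x.
have cf : continuous (fun x => cos (t * x) * sinusoid A B s x).
  rewrite (_ : (fun x => _) = (fun x => sinusoid 1 0 t x * sinusoid A B s x)).
    by apply: continuous_mul; exact: continuous_sinusoid.
  by apply/funext => x; rewrite cE.
rewrite -RintegralZl//; last exact: integrable_segment.
pose F x := -1 * (sinusoid (s * B) (- (s * A)) s x * sinusoid 1 0 t x)
   + sinusoid A B s x * sinusoid (t * 0) (- (t * 1)) t x.
transitivity (F l - F 0); first apply: (Rintegral_FTC_continuous F) => //.
- by apply: continuous_mul => //; exact: cst_continuous.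
- move=> x; apply: is_derive_eq (is_derive_add _ _ _ _ _
    (is_derive_scale _ _ _ _ (is_derive_mul _ _ _ _ _ (ddu x) (dc x)))
    (is_derive_mul _ _ _ _ _ (du x) (ddc x))) _.
  by rewrite !cE !dcE /sinusoid; ring.
- rewrite /F !cE !dcE stl !mulr0 sin0 cos0 /sinusoid !mulr0 cos0 sin0; ring.
Qed.

(** A primitive of [cos ^ 2] is [x / 2] minus [1 / (2 * t ^ 2)] times the product of the cosine and
    its derivative; that product vanishes at [0] and [l]. *)
Lemma Rintegral_cos_sqr t l : 0 <= l -> t != 0 -> sin (t * l) = 0 ->
  \int[mu]_(x in `[0, l]) (cos (t * x) * cos (t * x)) = l / 2.
Proof.
move=> l0 t0 stl.
have cE x : sinusoid 1 0 t x = cos (t * x) by rewrite /sinusoid mul1r mul0r addr0.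
have dcE x : sinusoid (t * 0) (- (t * 1)) t x = - t * sin (t * x).
  by rewrite /sinusoid; ring.
have dc x := is_derive_sinusoid 1 0 t x.
have ddc x := is_derive_sinusoid (t * 0) (- (t * 1)) t x.
pose F x := 2^-1 * x + (- (2 * t ^+ 2)^-1) *
  (sinusoid 1 0 t x * sinusoid (t * 0) (- (t * 1)) t x).
transitivity (F l - F 0); first apply: (Rintegral_FTC_continuous F) => //.
- rewrite (_ : (fun x => _) = (fun x => sinusoid 1 0 t x * sinusoid 1 0 t x)).
    by apply: continuous_mul; exact: continuous_sinusoid.
  by apply/funext => x; rewrite cE.
- move=> x; apply: is_derive_eq (is_derive_add _ _ _ _ _
    (is_derive_scale _ _ _ _ (is_derive_id x 1))
    (is_derive_scale _ _ _ _ (is_derive_mul _ _ _ _ _ (dc x) (ddc x)))) _.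
  have -> : cos (t * x) * cos (t * x) = 2^-1 * (cos (t * x) ^+ 2 +
      sin (t * x) ^+ 2) + 2^-1 * (cos (t * x) ^+ 2 - sin (t * x) ^+ 2) by field.
  by rewrite cos2Dsin2 !cE !dcE /sinusoid; field.
- by rewrite /F !dcE stl !mulr0 sin0 !mulr0; lra.
Qed.

(** The energy [s ^ 2 * u ^ 2 + u' ^ 2] is the constant [s ^ 2 * (A ^ 2 + B ^ 2)], and
    [(u * u')' = u' ^ 2 - s ^ 2 * u ^ 2]; subtracting gives the integrand. Without division the
    identity also covers [s = 0]. *)
Lemma Rintegral_sinusoid_sqr A B s l : 0 <= l ->
  2 * s ^+ 2 * \int[mu]_(x in `[0, l]) (sinusoid A B s x * sinusoid A B s x) =
  s ^+ 2 * (A ^+ 2 + B ^+ 2) * l + A * (s * B) -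
  sinusoid A B s l * sinusoid (s * B) (- (s * A)) s l.
Proof.
move=> l0.
have du x := is_derive_sinusoid A B s x.
have ddu x := is_derive_sinusoid (s * B) (- (s * A)) s x.
have cf : continuous (fun x => sinusoid A B s x * sinusoid A B s x).
  by apply: continuous_mul; exact: continuous_sinusoid.
rewrite -RintegralZl//; last exact: integrable_segment.
pose F x := (s ^+ 2 * (A ^+ 2 + B ^+ 2)) * x +
  -1 * (sinusoid A B s x * sinusoid (s * B) (- (s * A)) s x).
transitivity (F l - F 0); first apply: (Rintegral_FTC_continuous F) => //.
- by apply: continuous_mul => //; exact: cst_continuous.
- move=> x; apply: is_derive_eq (is_derive_add _ _ _ _ _
    (is_derive_scale _ _ _ _ (is_derive_id x 1))
    (is_derive_scale _ _ _ _ (is_derive_mul _ _ _ _ _ (du x) (ddu x)))) _.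
  rewrite -[A ^+ 2 + B ^+ 2]mulr1 -(cos2Dsin2 (s * x)) /sinusoid; ring.
- rewrite /F /sinusoid !mulr0 cos0 sin0; ring.
Qed.

(* With [T = tan (w * (x - m))], [m] the midpoint, the derivative of
   [w * u ^ 2 * T] is [(u' + w * u * T) ^ 2 - (u' ^ 2 - w ^ 2 * u ^ 2)]. *)
Lemma poincare_dirichlet u du w p q : p <= q -> 0 < w -> w * (q - p) < pi ->
  (forall x, is_derive x 1 u (du x)) -> continuous du ->
  u p = 0 -> u q = 0 ->
  w ^+ 2 * \int[mu]_(x in `[p, q]) (u x * u x) <=
  \int[mu]_(x in `[p, q]) (du x * du x).
Proof.
move=> pq w0 wpi hu cdu up uq.
have cu : continuous u by move=> x; exact: is_derive_continuous (hu x).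
pose m := (p + q) / 2.
pose T x := tan (w * (x - m)).
(* Since [w * (q - p) < pi], the angle stays strictly inside [(- pi / 2, pi / 2)] on the closed
   interval, so [T] has no pole there. *)
have cosN0 x : x \in `[p, q] -> cos (w * (x - m)) != 0.
  rewrite in_itv/= => /andP[px xq]; rewrite gt_eqF// cos_gt0_pihalf//.
  by rewrite /m; apply/andP; split; nra.
have dT x : x \in `[p, q] -> is_derive x 1 T (w * (1 + T x ^+ 2)).
  move=> xpq; have d : is_derive x 1 (fun y : R => w * (y - m)) w.
  by apply: is_derive_eq; rewrite /GRing.scale/= subr0 mulr1.
  have h := @is_derive1_comp R tan (fun y => w * (y - m)) x _ _
    (is_derive_tan (cosN0 _ xpq)) d.
  apply: (is_derive_eq h).
  by rewrite cos2_tan2 ?cosN0// mulrC.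
pose g x := w ^+ 2 * (u x * u x) - du x * du x +
  (du x + w * u x * T x) * (du x + w * u x * T x).
have cT : {within `[p, q], continuous T}.
  apply: derivable_within_continuous => x xpq.
  by have [] := dT x xpq.
have cS (h : R -> R) : continuous h -> {within `[p, q], continuous h}.
  exact: continuous_subspaceT.
have cN : {within `[p, q], continuous (fun x => w ^+ 2 * (u x * u x) - du x * du x)}.
  apply: cS => x; apply: cvgB; last by apply: cvgM; exact: cdu.
  by apply: cvgM; [exact: cvg_cst|apply: cvgM; exact: cu].
have cSq : {within `[p, q], continuous
    (fun x => (du x + w * u x * T x) * (du x + w * u x * T x))}.
  move=> x.
  have c1 : {for x, continuous
     ((fun x => du x + w * u x * T x) : subspace `[p, q] -> R)}.
    apply: cvgD; first exact: (cS _ cdu x).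
    apply: cvgM; last exact: cT.
    by apply: cvgM; [exact: cvg_cst|exact: (cS _ cu x)].
  exact: cvgM.
have : \int[mu]_(x in `[p, q]) g x = 0.
  pose F x := w * (u x * u x * T x).
  have cg : {within `[p, q], continuous g}.
    by move=> x; apply: cvgD; [exact: cN|exact: cSq].
  have dF x : x \in `[p, q] -> is_derive x 1 F (g x).
    move=> xpq; have h := is_derive_scale _ w _ _
      (is_derive_mul _ _ _ _ _ (is_derive_mul _ _ _ _ _ (hu x) (hu x))
      (dT x xpq)).
    by apply: (is_derive_eq h); rewrite /g; ring.
  by rewrite (Rintegral_FTC _ _ _ _ pq cg dF) /F up uq !(mul0r, mulr0) subrr.
have iN := continuous_integrable_segment _ _ _ cN.
rewrite RintegralD//; last exact: continuous_integrable_segment.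
have : 0 <= \int[mu]_(x in `[p, q]) ((du x + w * u x * T x) * (du x + w * u x * T x)).
  by apply: Rintegral_ge0 => x _; rewrite -expr2 sqr_ge0.
have iu2 : mu.-integrable `[p, q] (EFin \o (fun x => u x * u x)).
  by apply: integrable_segment; exact: continuous_mul.
rewrite RintegralB//; last 2 first.
- apply: integrable_segment; apply: continuous_mul; first exact: cst_continuous.
  exact: continuous_mul.
- by apply: integrable_segment; exact: continuous_mul.
by rewrite RintegralZl//; lra.
Qed.

End calculus.

(** * Weak derivatives on an interval *)

Section regularity.
Context {R : realType}.
Notation mu := (@lebesgue_measure R).
Implicit Types (f g u du : R -> R) (a x : R).

Lemma EFin_Rintegral (D : set R) f : measurable D ->
  mu.-integrable D (EFin \o f) ->
  (\int[mu]_(x in D) (f x)%:E)%E = (\int[mu]_(x in D) f x)%:E.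
Proof. by move=> mD fi; rewrite /Rintegral fineK//; exact: integrable_fin_num. Qed.

Lemma integrable_patch (D : set R) f : measurable D ->
  mu.-integrable D (EFin \o f) -> mu.-integrable setT (EFin \o (f \_ D)).
Proof.
move=> mD fi; rewrite -restrict_EFin; apply/integrable_restrict => //=.
by rewrite setTI.
Qed.

Lemma integrable_scale (D : set R) (c : R) f : measurable D ->
  mu.-integrable D (EFin \o f) -> mu.-integrable D (EFin \o (fun x => c * f x)).
Proof.
move=> mD fi; have := @integrableZl _ _ _ _ _ _ c _ fi => /(_ mD).
by congr (mu.-integrable D _); apply/funext => x /=; rewrite EFinM.
Qed.

Lemma integrable_fun_mul f g : mu.-integrable setT (EFin \o f) ->
  mu.-integrable setT (EFin \o g) ->
  (mu \x mu)%E.-integrable setT (EFin \o (fun z : R * R => f z.1 * g z.2)).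
Proof.
move=> fi gi.
have mf : measurable_fun setT f.
  by apply/measurable_EFinP; exact: measurable_int fi.
have mg : measurable_fun setT g.
  by apply/measurable_EFinP; exact: measurable_int gi.
apply/integrable12ltyP.
  apply/measurable_EFinP; apply: measurable_funM; exact: measurableT_comp.
have gi' := integrable_norm gi.
pose C := \int[mu]_y `|g y|.
rewrite (_ : (fun x => _) = (fun x => (C * `|f x|)%:E)).
  apply: integrable_lty => //; apply: integrable_scale => //.
  exact: integrable_norm.
apply/funext => x /=; under eq_integral do rewrite normrM.
rewrite EFin_Rintegral//; last exact: integrable_scale.
by rewrite RintegralZl// mulrC.
Qed.

(** Fubini on the square for [f x * g t] cut off to the triangle [t <= x]. *)
Lemma Rintegral_triangle f g a :
  mu.-integrable `[0, a] (EFin \o f) -> mu.-integrable `[0, a] (EFin \o g) ->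
  \int[mu]_(x in `[0, a]) (f x * \int[mu]_(t in `[0, x]) g t) =
  \int[mu]_(t in `[0, a]) (g t * \int[mu]_(x in `[t, a]) f x).
Proof.
move=> fi gi.
pose f0 := f \_ `[0, a]; pose g0 := g \_ `[0, a].
have f0i : mu.-integrable setT (EFin \o f0) by exact: integrable_patch.
have g0i : mu.-integrable setT (EFin \o g0) by exact: integrable_patch.
(* The indicator of the triangle is bounded and measurable, so multiplying by it preserves
   integrability. *)
pose k (z : R * R) : R := if z.2 <= z.1 then 1 else 0.
have mk : measurable_fun setT k.
  apply: measurable_fun_ifT => //.
  by apply: measurable_fun_ler.
pose h (z : R * R) : R := f0 z.1 * g0 z.2 * k z.
have ih : (mu \x mu)%E.-integrable setT (EFin \o h).
  apply: (integrableMl measurableT (integrable_fun_mul _ _ f0i g0i) mk).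
  exists 1; split; rewrite ?num_real// => M M1 z _ /=.
  by rewrite /k; case: ifP => _; rewrite ?normr1 ?normr0 ltW// (lt_trans ltr01).
have HL x : (\int[mu]_t (h (x, t))%:E)%E =
   (((fun x => f x * \int[mu]_(t in `[0, x]) g t) \_ `[0, a]) x)%:E.
  rewrite patchE; case: ifPn => [xa|/negbTE xa].
    have E t : h (x, t) = f x * (g \_ `[0, x]) t.
      rewrite /h /k /f0 /g0 !patchE xa/= !mem_setE.
      move: xa; rewrite mem_setE !in_itv/= => /andP[x0 xa].
      have [tx|xt] := leP t x; rewrite ?mulr1 ?mulr0 ?andbF ?mulr0//.
      by rewrite (le_trans tx xa).
    under eq_integral do rewrite E.
    have ix : mu.-integrable `[0, x] (EFin \o g).
      apply: integrableS gi => //; apply: subset_itvl; move: xa.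
      by rewrite inE/= in_itv/= bnd_simp => /andP[].
    have ix' := integrable_patch _ _ (measurable_itv _) ix.
    rewrite EFin_Rintegral//; last exact: integrable_scale.
    by rewrite RintegralZl// -Rintegral_mkcond.
  under eq_integral do rewrite /h /f0 /= patchE xa !mul0r.
  by rewrite integral0.
have HR t : (\int[mu]_x (h (x, t))%:E)%E =
   (((fun t => g t * \int[mu]_(x in `[t, a]) f x) \_ `[0, a]) t)%:E.
  rewrite patchE; case: ifPn => [ta|/negbTE ta].
    have E x : h (x, t) = g t * (f \_ `[t, a]) x.
      rewrite /h /k /f0 /g0 !patchE ta/= !mem_setE.
      move: ta; rewrite mem_setE !in_itv/= => /andP[t0 ta].
      have [tx|xt] := leP t x; rewrite ?mulr1 ?mulr0 ?andbF ?mulr0//.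
      by rewrite (le_trans t0 tx) mulrC.
    under eq_integral do rewrite E.
    have ix : mu.-integrable `[t, a] (EFin \o f).
      apply: integrableS fi => //; apply: subset_itvr; move: ta.
      by rewrite inE/= in_itv/= bnd_simp => /andP[].
    have ix' := integrable_patch _ _ (measurable_itv _) ix.
    rewrite EFin_Rintegral//; last exact: integrable_scale.
    by rewrite RintegralZl// -Rintegral_mkcond.
  under eq_integral do rewrite /h /g0 /= patchE ta mulr0 mul0r.
  by rewrite integral0.
rewrite Rintegral_mkcond [RHS]Rintegral_mkcond /Rintegral.
under eq_integral do rewrite -HL.
under [in RHS]eq_integral do rewrite -HR.
congr fine; exact: (Fubini ih).
Qed.


Lemma integrable_L2_mul (D : set (measurableTypeR R)) f g : measurable D ->
  f \_ D \in Lfun mu 2%:E -> g \_ D \in Lfun mu 2%:E ->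
  mu.-integrable D (EFin \o (fun x => f x * g x)).
Proof.
move=> mD lf lg; have := Lfun2_mul_Lfun1 lf lg.
move/Lfun1_integrable; rewrite (_ : _ \* _ = (fun x => f x * g x) \_ D).
  by rewrite -restrict_EFin => /(integrable_mkcond _ mD).2.
by apply/funext => x /=; rewrite !patchE; case: ifP => _; rewrite ?mulr0.
Qed.

Lemma continuous_L2 f a : {within `[0, a], continuous f} ->
  f \_ `[0, a] \in Lfun mu 2%:E.
Proof.
move=> cf.
have fi := integrable_patch _ _ (measurable_itv _)
  (continuous_integrable_segment _ _ _ cf).
have ffi : mu.-integrable `[0, a] (EFin \o (fun x => f x * f x)).
  apply: continuous_integrable_segment.
  by move=> x; apply: cvgM; exact: cf.
have {}ffi := integrable_patch _ _ (measurable_itv _) ffi.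
rewrite inE; apply/andP; split; rewrite inE/=.
  by apply/measurable_EFinP; exact: measurable_int fi.
rewrite /finite_norm unlock /Lnorm poweR_lty//.
rewrite (_ : (fun x => _) = EFin \o ((fun x => f x * f x) \_ `[0, a])).
  exact: integrable_lty.
apply/funext => x /=; congr EFin.
rewrite !patchE; case: ifP => _; last by rewrite normr0 powR0// pnatr_eq0.
by rewrite powR_mulrn// real_normK ?num_real// expr2.
Qed.

Lemma Rintegral_ae_eq (D : set (measurableTypeR R)) f g : measurable D ->
  measurable_fun D f -> measurable_fun D g ->
  {ae mu, forall x, D x -> f x = g x} ->
  \int[mu]_(x in D) f x = \int[mu]_(x in D) g x.
Proof.
have ae_filter := ae_filter_ringOfSetsType mu.
move=> mD mf mg fg; congr fine; apply: ae_eq_integral => //.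
- exact/measurable_EFinP.
- exact/measurable_EFinP.
- by apply: filterS fg => x + Dx => /(_ Dx) /= ->.
Qed.

Lemma Rintegral_sqr_eq0 (D : set (measurableTypeR R)) f : measurable D ->
  mu.-integrable D (EFin \o (fun x => f x * f x)) ->
  \int[mu]_(x in D) (f x * f x) = 0 -> {ae mu, forall x, D x -> f x = 0}.
Proof.
have ae_filter := ae_filter_ringOfSetsType mu.
move=> mD fi f0; have : (\int[mu]_(x in D) (f x * f x)%:E = 0)%E.
  by rewrite EFin_Rintegral// f0.
under eq_integral => x _.
  rewrite -[X in X%:E]ger0_norm; last by rewrite -expr2 sqr_ge0.
  over.
move=> /(ae_eq_integral_abs mu mD (measurable_int _ fi)).
apply: filterS => x /= + Dx => /(_ Dx) [] /eqP.
by rewrite mulf_eq0 orbb => /eqP.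
Qed.

(* du Bois-Reymond: with [W] the primitive of [w] and [c] the mean of [du + W],
   testing against [g = du + W - c] shows that [g] has norm 0. *)
Lemma weak_derivative_ae w du a : 0 < a ->
  du \_ `[0, a] \in Lfun mu 2%:E ->
  mu.-integrable `[0, a] (EFin \o w) ->
  (forall g, g \_ `[0, a] \in Lfun mu 2%:E -> \int[mu]_(x in `[0, a]) g x = 0 ->
    \int[mu]_(x in `[0, a]) (du x * g x) =
    \int[mu]_(x in `[0, a]) (w x * \int[mu]_(t in `[0, x]) g t)) ->
  exists c, {ae mu, forall x, x \in `[0, a] ->
    du x = c - \int[mu]_(t in `[0, x]) w t}.
Proof.
have ae_filter := ae_filter_ringOfSetsType mu.
move=> a0 ldu wi hw.
pose W x := \int[mu]_(t in `[0, x]) w t.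
have cW : {within `[0, a], continuous W}.
  by apply: parameterized_integral_continuous => //; exact: ltW.
have mD : measurable (`[0, a] : set (measurableTypeR R)) by exact: measurable_itv.
have lW : W \_ `[0, a] \in Lfun mu 2%:E by exact: continuous_L2.
have lc (k : R) : (fun=> k) \_ `[0, a] \in Lfun mu 2%:E.
  by apply: continuous_L2; exact: continuous_subspaceT (fun x => cvg_cst _).
have L2i f : f \_ `[0, a] \in Lfun mu 2%:E -> mu.-integrable `[0, a] (EFin \o f).
  move=> lf; have := integrable_L2_mul _ _ _ mD (lc 1) lf.
  by congr (mu.-integrable _ _); apply/funext => x /=; rewrite mul1r.
have L2D f g : f \_ `[0, a] \in Lfun mu 2%:E -> g \_ `[0, a] \in Lfun mu 2%:E ->
    (fun x => f x + g x) \_ `[0, a] \in Lfun mu 2%:E.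
  move=> lf lg.
  rewrite (_ : _ \_ _ = f \_ `[0, a] + g \_ `[0, a]).
    by have [_] := Lfun_addr_closed mu (lee1n 2); exact.
  by apply/funext => x; rewrite fctE !patchE; case: ifP; rewrite ?addr0.
pose h x := du x + W x.
have lh : h \_ `[0, a] \in Lfun mu 2%:E by exact: L2D.
(* Subtracting the mean makes [g] an admissible test: its integral over [[0, a]] is zero. *)
pose c := (\int[mu]_(x in `[0, a]) h x) / a.
pose g x := h x + - c.
have lg : g \_ `[0, a] \in Lfun mu 2%:E by apply: L2D.
have g0 : \int[mu]_(x in `[0, a]) g x = 0.
  rewrite RintegralD//; [|exact: L2i..].
  rewrite Rintegral_cst//= lebesgue_measure_itv/= lte_fin a0 oppr0 adde0/=.
  by rewrite /c mulNr divfK ?subrr// gt_eqF.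
have ggi := integrable_L2_mul _ _ _ mD lg lg.
have gdui := integrable_L2_mul _ _ _ mD ldu lg.
have gWi := integrable_L2_mul _ _ _ mD lg lW.
have gi := L2i _ lg.
(* After exchanging the integrals, the inner one is [W a - W t], and the [W a] term disappears
   because [g] has mean zero. *)
have e1 : \int[mu]_(x in `[0, a]) (du x * g x) =
    - \int[mu]_(x in `[0, a]) (g x * W x).
  rewrite hw// Rintegral_triangle//.
  transitivity (\int[mu]_(t in `[0, a]) (W a * g t - g t * W t)).
    apply: eq_Rintegral => t; rewrite mem_setE in_itv/= => /andP[t0 ta].
    rewrite -Rintegral_itv_obnd_cbnd; last first.
      apply: integrableS wi => //; apply: subset_itvr.
      by rewrite bnd_simp.
    by rewrite -(@Rintegral_itvB _ _ (BLeft 0))//= ?bnd_simp// -/(W a) -/(W t); ring.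
  rewrite RintegralB//; last exact: integrable_scale.
  by rewrite RintegralZl// g0 mulr0 sub0r.
exists c.
have : \int[mu]_(x in `[0, a]) (g x * g x) = 0.
  transitivity (\int[mu]_(x in `[0, a]) ((du x * g x + g x * W x) - c * g x)).
    by apply: eq_Rintegral => x _; rewrite /g /h; ring.
  rewrite RintegralB//; last 2 first.
  - have := integrable_L2_mul _ _ _ mD lg lh.
    congr (mu.-integrable _ _); apply/funext => x /=.
    by congr EFin; rewrite /h; ring.
  - exact: integrable_scale.
  by rewrite RintegralD// e1 RintegralZl// g0 mulr0 subr0 addNr.
move=> /(Rintegral_sqr_eq0 _ _ mD ggi).
apply: filterS => x + Dx => /(_ Dx) /eqP.
by rewrite /g /h subr_eq0 => /eqP <-; rewrite addrK.
Qed.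

End regularity.

(** * The oscillator equation *)

Section ode.
Context {R : realType}.
Notation mu := (@lebesgue_measure R).
Implicit Types (f g u v : R -> R) (a x : R).

Lemma is_derive_parameterized_integral f a x : {within `[0, a], continuous f} ->
  0 < x < a -> is_derive x 1 (fun y => \int[mu]_(t in `[0, y]) f t) (f x).
Proof.
move=> cf /andP[x0 xa].
have a0 : 0 < a by exact: lt_trans xa.
have /(continuous_within_itvP _ a0)[cfo _ _] := cf.
have cfx : {for x, continuous f} by apply: cfo; rewrite in_itv/= x0 xa.
have := continuous_FTC1_closed xa (continuous_integrable_segment _ _ _ cf) x0 cfx.
by move=> [d e]; split=> //; rewrite -derive1E.
Qed.

Lemma derive0_segment_cst f a : {within `[0, a], continuous f} ->
  (forall x, 0 < x < a -> is_derive x 1 f 0) ->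
  forall x, 0 <= x <= a -> f x = f 0.
Proof.
move=> cf df x /andP[x0 xa].
have cx : {within `[0, x], continuous f}.
  by apply: continuous_subspaceW cf; apply: subset_itvl; rewrite bnd_simp.
have [y|c _ /eqP] := @MVT_segment _ f (fun=> 0) 0 x x0 _ cx.
  by rewrite in_itv/= => /andP[y0 yx]; apply: df; rewrite y0 (lt_le_trans yx).
by rewrite mul0r subr_eq0 => /eqP.
Qed.

(** In integral form the system is [u' = v], [v' = - s ^ 2 * u]. Rotating the vector [(u, v / s)] by
    the angle [s * x] makes it constant, and rotating back gives the formulas. *)
Lemma ode_sinusoid u c s a : 0 < a -> 0 < s ->
  {within `[0, a], continuous u} ->
  let v x := c - \int[mu]_(t in `[0, x]) (s ^+ 2 * u t) in
  (forall x, 0 <= x <= a -> u x = u 0 + \int[mu]_(t in `[0, x]) v t) ->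
  forall x, 0 <= x <= a ->
    u x = sinusoid (u 0) (c / s) s x /\
    v x = sinusoid (s * (c / s)) (- (s * u 0)) s x.
Proof.
move=> a0 s0 cu v hu.
have cM f g : {within `[0, a], continuous f} -> {within `[0, a], continuous g} ->
    {within `[0, a], continuous (fun x => f x * g x)}.
  by move=> cf cg x; apply: cvgM; [exact: cf|exact: cg].
have cD f g : {within `[0, a], continuous f} -> {within `[0, a], continuous g} ->
    {within `[0, a], continuous (fun x => f x + g x)}.
  by move=> cf cg x; apply: cvgD; [exact: cf|exact: cg].
have cc (k : R) : {within `[0, a], continuous (fun=> k)}.
  exact: continuous_subspaceT (fun x => cvg_cst _).
have csu : {within `[0, a], continuous (fun t => s ^+ 2 * u t)} by exact: cM.
have cI f : {within `[0, a], continuous f} ->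
    {within `[0, a], continuous (fun x => \int[mu]_(t in `[0, x]) f t)}.
  move=> cf; apply: (@parameterized_integral_continuous R 0 a f (ltW a0)).
  exact: continuous_integrable_segment.
have cv : {within `[0, a], continuous v}.
  by move=> x; apply: cvgB; [exact: cc|exact: cI].
(* [w] equals [u] on the segment and, being a primitive, can be differentiated directly; the values
   of [u] outside the segment are arbitrary. *)
pose w x := u 0 + \int[mu]_(t in `[0, x]) v t.
have cw : {within `[0, a], continuous w} by apply: cD => //; exact: cI.
have dw x : 0 < x < a -> is_derive x 1 w (v x).
  move=> xa; have h := is_derive_parameterized_integral _ _ _ cv xa.
  apply: (is_derive_eq (is_derive_add _ _ _ _ _ (is_derive_cst (u 0) x 1) h)).
  by rewrite add0r.
have dv x : 0 < x < a -> is_derive x 1 v (- (s ^+ 2 * u x)).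
  move=> xa; have h := is_derive_parameterized_integral _ _ _ csu xa.
  by apply: (is_derive_eq (is_deriveB (is_derive_cst c x 1) h)); rewrite sub0r.
have uw x : 0 <= x <= a -> u x = w x by exact: hu.
have oo x : 0 < x < a -> 0 <= x <= a by move=> /andP[/ltW -> /ltW ->].
pose C x := sinusoid 1 0 s x; pose S x := sinusoid 0 1 s x.
have CE x : C x = cos (s * x) by rewrite /C /sinusoid mul1r mul0r addr0.
have SE x : S x = sin (s * x) by rewrite /S /sinusoid mul1r mul0r add0r.
have cC : {within `[0, a], continuous C}.
  by apply: continuous_subspaceT; exact: continuous_sinusoid.
have cS : {within `[0, a], continuous S}.
  by apply: continuous_subspaceT; exact: continuous_sinusoid.
have dC x := is_derive_sinusoid 1 0 s x : is_derive x 1 C _.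
have dS x := is_derive_sinusoid 0 1 s x : is_derive x 1 S _.
have sn0 : s != 0 by rewrite gt_eqF.
(* [P] and [Q] are the constants of motion, equal to [u 0] and [c / s]. *)
pose P x := w x * C x + - s^-1 * (v x * S x).
pose Q x := w x * S x + s^-1 * (v x * C x).
have Pcst : forall x, 0 <= x <= a -> P x = P 0.
  apply: derive0_segment_cst.
    by apply: (cD); apply: (cM) => //; apply: (cM) => //; exact: (cc).
  move=> x xa; apply: (is_derive_eq (is_derive_add _ _ _ _ _
    (is_derive_mul _ _ _ _ _ (dw x xa) (dC x))
    (is_derive_scale _ _ _ _ (is_derive_mul _ _ _ _ _ (dv x xa) (dS x))))).
  by rewrite uw ?oo// CE SE /sinusoid; field.
have Qcst : forall x, 0 <= x <= a -> Q x = Q 0.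
  apply: derive0_segment_cst.
    by apply: (cD); apply: (cM) => //; apply: (cM) => //; exact: (cc).
  move=> x xa; apply: (is_derive_eq (is_derive_add _ _ _ _ _
    (is_derive_mul _ _ _ _ _ (dw x xa) (dS x))
    (is_derive_scale _ _ _ _ (is_derive_mul _ _ _ _ _ (dv x xa) (dC x))))).
  by rewrite uw ?oo// CE SE /sinusoid; field.
have v0 : v 0 = c by rewrite /v set_itv1 Rintegral_set1 subr0.
have w0 : w 0 = u 0 by rewrite /w set_itv1 Rintegral_set1 addr0.
move=> x xa; have := Pcst x xa; have := Qcst x xa.
rewrite /P /Q v0 w0 !CE !SE mulr0 cos0 sin0 !mulr0 !mulr1 add0r addr0.
have cs := cos2Dsin2 (s * x).
(* The two conservation laws are solved for [u x] and [v x] with [cos ^ 2 + sin ^ 2 = 1]. *)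
rewrite -(uw x xa) => eQ eP; rewrite /sinusoid -eP (mulrC c) -eQ; split.
  transitivity (u x * (cos (s * x) ^+ 2 + sin (s * x) ^+ 2)); last by ring.
  by rewrite cs mulr1.
transitivity (v x * (cos (s * x) ^+ 2 + sin (s * x) ^+ 2)); last by field.
by rewrite cs mulr1.
Qed.

End ode.

(** * Regularity of eigenfunctions *)

Section graph_regularity.
Context {R : realType} {G : metricGraph R}.
Notation mu := (@lebesgue_measure R).
Implicit Types (u du v dv f : graph_fun G) (e : edge G).

Let mD (a : R) : measurable (`[0, a] : set (measurableTypeR R)).
Proof. exact: measurable_itv. Qed.

Lemma L2_integrable (f : R -> R) (a : R) :
  f \_ `[0, a] \in Lfun mu 2%:E -> mu.-integrable `[0, a] (EFin \o f).
Proof.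
move=> lf; have l1 : (fun=> 1 : R) \_ `[0, a] \in Lfun mu 2%:E.
  by apply: continuous_L2; exact: continuous_subspaceT (fun x => cvg_cst _).
have := integrable_L2_mul _ _ _ (mD a) l1 lf.
by congr (mu.-integrable _ _); apply/funext => x /=; rewrite mul1r.
Qed.

Lemma H1_deriv_continuous u du e : H1_deriv u du ->
  {within `[0, len e], continuous u e}.
Proof.
move=> [ldu hu _].
have c : {within `[0, len e], continuous
    (fun x => \int[mu]_(t in `[0, x]) du e t)}.
  apply: (@parameterized_integral_continuous R 0 (len e) _ (ltW (len_gt0 e))).
  exact: L2_integrable.
apply: (@subspace_eq_continuous R `[0, len e] R
   (fun x => u e 0 + \int[mu]_(t in `[0, x]) du e t) (u e)).
  by move=> x; rewrite mem_setE in_itv/= => xe; rewrite -hu.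
move=> x; apply: cvgD; last exact: c.
exact: (continuous_subspaceT (fun x => cvg_cst _)).
Qed.

Definition edge_primitive e (g : R -> R) : graph_fun G :=
  fun e' x => \int[mu]_(t in `[0, x]) (if e' == e then g t else 0).

(** Mean zero makes the primitive vanish at both ends of [e], so the value 0 at every vertex gives
    continuity, also when [e] is a loop. *)
Lemma H1_deriv_edge_primitive e (g : R -> R) : g \_ `[0, len e] \in Lfun mu 2%:E ->
  \int[mu]_(x in `[0, len e]) g x = 0 ->
  H1_deriv (edge_primitive e g) (fun e' x => if e' == e then g x else 0).
Proof.
move=> lg g0; split.
- move=> e'; case: eqP => [->//|_].
  by apply: continuous_L2; exact: continuous_subspaceT (fun x => cvg_cst _).
- by move=> e' x _; rewrite /edge_primitive set_itv1 Rintegral_set1 add0r.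
- exists (fun=> 0) => e'; rewrite /edge_primitive set_itv1 Rintegral_set1; split=> //.
  case: eqP => [->//|_].
  by rewrite Rintegral_cst ?mul0r//; exact: mD.
Qed.

Lemma ip_edge u e (g : R -> R) :
  ip u (fun e' x => if e' == e then g x else 0) =
  \int[mu]_(x in `[0, len e]) (u e x * g x).
Proof.
rewrite /ip (bigD1 e)//= eqxx big1 ?addr0// => e' /negbTE e'e.
under eq_Rintegral do rewrite e'e mulr0.
by rewrite Rintegral_cst ?mul0r//; exact: mD.
Qed.

Lemma ip_edge_primitive u e (g : R -> R) :
  ip u (edge_primitive e g) =
  \int[mu]_(x in `[0, len e]) (u e x * \int[mu]_(t in `[0, x]) g t).
Proof.
rewrite -ip_edge /ip; apply: eq_bigr => e' _; apply: eq_Rintegral => x _.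
rewrite /edge_primitive; case: eqP => // _.
by rewrite Rintegral_cst ?mul0r//; exact: measurable_itv.
Qed.

(** Tests supported on the single edge [e] reduce the form equation on the graph to the one on an
    interval. *)
Lemma weak_derivative_edge f u du e : 
  {within `[0, len e], continuous f e} -> H1_deriv u du ->
  (forall v dv, H1_deriv v dv -> ip du dv = ip f v) ->
  exists c, {ae mu, forall x, x \in `[0, len e] ->
    du e x = c - \int[mu]_(t in `[0, x]) f e t}.
Proof.
move=> cf [ldu _ _] weak; apply: weak_derivative_ae => //.
- exact: len_gt0.
- exact: continuous_integrable_segment.
- move=> g lg g0; have := weak _ _ (H1_deriv_edge_primitive _ _ lg g0).
  by rewrite ip_edge ip_edge_primitive.
Qed.

(** Replaces the weak derivative by a continuous representative, so that the classical calculus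
    applies. *)
Lemma H1_deriv_ae u du e (w : R -> R) : H1_deriv u du ->
  {within `[0, len e], continuous w} ->
  {ae mu, forall x, x \in `[0, len e] -> du e x = w x} ->
  forall x, 0 <= x <= len e -> u e x = u e 0 + \int[mu]_(t in `[0, x]) w t.
Proof.
have ae_filter := ae_filter_ringOfSetsType mu.
move=> [ldu hu _] cw duw x xe; rewrite hu//; congr (_ + _).
have sub : `[0, x] `<=` `[0, len e].
  by apply: subset_itvl; rewrite bnd_simp; case/andP: xe.
apply: Rintegral_ae_eq; first exact: mD.
- apply: (measurable_funS (mD (len e)) sub).
  have h := L2_integrable _ _ (ldu e).
  by apply/measurable_EFinP; exact: measurable_int h.
- apply: (measurable_funS (mD (len e)) sub).
  have h := continuous_integrable_segment _ _ _ cw.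
  by apply/measurable_EFinP; exact: measurable_int h.
- by apply: filterS duw => y h /sub; exact: h.
Qed.

Lemma ip_sqr_eq0 u : inL2 u -> ip u u = 0 ->
  forall e, {ae mu, forall x, x \in `[0, len e] -> u e x = 0}.
Proof.
move=> lu /eqP; rewrite /ip psumr_eq0; last first.
  by move=> e _; apply: Rintegral_ge0 => x _; rewrite -expr2 sqr_ge0.
move=> /allP u0 e; have /eqP := u0 e (mem_index_enum _).
apply: Rintegral_sqr_eq0; first exact: mD.
by apply: integrable_L2_mul => //; exact: mD.
Qed.

(** For [s > 0], du Bois-Reymond gives [u'] a continuous representative and [u] then solves the
    oscillator equation; for [s = 0] the energy vanishes and [u] is constant on each edge. The weak
    equation is returned too, since it yields the orthogonality of the derivatives. *)
Lemma eigenfunction_sinusoid (s : R) u : 0 <= s -> eigenfunction (s ^+ 2) u ->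
  exists A B : edge G -> R,
    (forall e x, 0 <= x <= len e -> u e x = sinusoid (A e) (B e) s x) /\
    exists2 du, H1_deriv u du &
      (forall v dv, H1_deriv v dv -> ip du dv = ip (fun e x => s ^+ 2 * u e x) v) /\
      forall e, {ae mu, forall x, x \in `[0, len e] ->
        du e x = sinusoid (s * B e) (- (s * A e)) s x}.
Proof.
have ae_filter := ae_filter_ringOfSetsType mu.
rewrite le_eqVlt => /predU1P[<-|s0] [[_ [du hdu weak]] _].
  have du0 : forall e, {ae mu, forall x, x \in `[0, len e] -> du e x = 0}.
    case: (hdu) => ldu _ _; apply: ip_sqr_eq0 => //.
    (* Testing the equation against [u] itself shows that the derivative has norm zero. *)
    rewrite (weak _ _ hdu) /ip big1// => e _.
    under eq_Rintegral do rewrite expr0n/= !mul0r.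
    by rewrite Rintegral_cst ?mul0r//; exact: mD.
  have cst0 e : {within `[0, len e], continuous (fun=> 0 : R)}.
    exact: continuous_subspaceT (fun x => cvg_cst _).
  exists (fun e => u e 0), (fun=> 0); split.
    move=> e x xe; rewrite (H1_deriv_ae _ _ _ _ hdu (cst0 e) (du0 e))//.
    rewrite Rintegral_cst ?mul0r ?addr0; last exact: measurable_itv.
    by rewrite /sinusoid !mul0r cos0 mulr1 addr0.
  exists du => //; split=> // e; apply: filterS (du0 e) => x h xe.
  by rewrite h// /sinusoid; ring.
have cu e := H1_deriv_continuous _ _ e hdu.
have csu e : {within `[0, len e], continuous (fun x => s ^+ 2 * u e x)}.
  by move=> x; apply: cvgM; [exact: cvg_cst|exact: cu].
have /choice[c hc] e := weak_derivative_edge _ _ _ e (csu e) hdu weak.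
have cv e : {within `[0, len e], continuous
    (fun x => c e - \int[mu]_(t in `[0, x]) (s ^+ 2 * u e t))}.
  move=> x; apply: cvgB; first exact: cvg_cst.
  apply: (@parameterized_integral_continuous R 0 (len e) _ (ltW (len_gt0 e))).
  exact: continuous_integrable_segment.
have hode e := ode_sinusoid (u e) (c e) s _ (len_gt0 e) s0 (cu e)
   (H1_deriv_ae _ _ e _ hdu (cv e) (hc e)).
exists (fun e => u e 0), (fun e => c e / s); split.
  by move=> e x xe; have [] := hode e x xe.
exists du => //; split=> // e; apply: filterS (hc e) => x h xe.
by rewrite h//; move: xe; rewrite in_itv/= => xe; have [] := hode e x xe.
Qed.

End graph_regularity.

(** * Inner product of edgewise continuous functions *)

Section inner_product.
Context {R : realType} {G : metricGraph R}.
Notation mu := (@lebesgue_measure R).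
Implicit Types (u v w f : graph_fun G) (e : edge G).

(** Continuity is asked on the whole line, as sinusoids have it, so that every product is integrable
    on every segment. Nothing is asked at the vertices. *)
Definition edgewise_continuous u := forall e, continuous (u e).

Lemma edgewise_continuous_lin u v (c : R) : edgewise_continuous u ->
  edgewise_continuous v -> edgewise_continuous (fun e x => u e x + c * v e x).
Proof.
move=> cu cv e x; apply: cvgD; first exact: cu.
by apply: cvgM; [exact: cvg_cst|exact: cv].
Qed.

Lemma edgewise_continuous_sum n (c : nat -> R) (s : nat -> graph_fun G) :
  (forall j, edgewise_continuous (s j)) ->
  edgewise_continuous (fun e x => \sum_(j < n) c j * s j e x).
Proof.
move=> cs; elim: n => [|n ih].
  by move=> e x; under eq_fun do rewrite big_ord0; exact: cvg_cst.
rewrite (_ : (fun e x => _) = (fun e x => \sum_(j < n) c j * s j e x + c n * s n e x)).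
  exact: edgewise_continuous_lin.
by apply/funext => e; apply/funext => x; rewrite big_ord_recr.
Qed.

Lemma eq_ip u u' v v' :
  (forall e x, 0 <= x <= len e -> u e x = u' e x) ->
  (forall e x, 0 <= x <= len e -> v e x = v' e x) -> ip u v = ip u' v'.
Proof.
move=> uu' vv'; apply: eq_bigr => e _; apply: eq_Rintegral => x.
by rewrite mem_setE in_itv/= => xe; rewrite uu'// vv'.
Qed.

Lemma ipC u v : ip u v = ip v u.
Proof.
by apply: eq_bigr => e _; apply: eq_Rintegral => x _; rewrite mulrC.
Qed.

Lemma ip_ge0 u : 0 <= ip u u.
Proof.
apply: sumr_ge0 => e _; apply: Rintegral_ge0 => x _.
by rewrite -expr2 sqr_ge0.
Qed.

Lemma ip_linr u v w (c : R) : edgewise_continuous u -> edgewise_continuous v ->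
  edgewise_continuous w ->
  ip u (fun e x => v e x + c * w e x) = ip u v + c * ip u w.
Proof.
move=> cu cv cw; rewrite /ip mulr_sumr -big_split/=; apply: eq_bigr => e _.
have iv : mu.-integrable `[0, len e] (EFin \o (fun x => u e x * v e x)).
  by apply: integrable_segment; exact: continuous_mul.
have iw : mu.-integrable `[0, len e] (EFin \o (fun x => u e x * w e x)).
  by apply: integrable_segment; exact: continuous_mul.
rewrite -RintegralZl//.
rewrite -RintegralD//; last exact: integrable_scale.
by apply: eq_Rintegral => x _; ring.
Qed.

Lemma ip_sumr u n (c : nat -> R) (s : nat -> graph_fun G) :
  edgewise_continuous u -> (forall j, edgewise_continuous (s j)) ->
  ip u (fun e x => \sum_(j < n) c j * s j e x) = \sum_(j < n) c j * ip u (s j).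
Proof.
move=> cu cs; elim: n => [|n ih].
  rewrite big_ord0 /ip big1// => e _.
  under eq_Rintegral do rewrite big_ord0 mulr0.
  by rewrite Rintegral_cst ?mul0r//; exact: measurable_itv.
rewrite big_ord_recr/= -ih -ip_linr//; last exact: edgewise_continuous_sum.
by apply: eq_ip => // e x _; rewrite big_ord_recr.
Qed.

(** The weights [d] allow one statement for the orthonormal eigenfunctions ([d = 1]) and for their
    derivatives ([d j] the eigenvalue). *)
Lemma ip_sum_sum n (c : nat -> R) (s : nat -> graph_fun G) (d : nat -> R) :
  (forall j, edgewise_continuous (s j)) ->
  (forall i j, ip (s i) (s j) = d i * (i == j)%:R) ->
  let u : graph_fun G := fun e x => \sum_(j < n) c j * s j e x in
  ip u u = \sum_(j < n) d j * c j ^+ 2.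
Proof.
move=> cs os u.
have cu : edgewise_continuous u by exact: edgewise_continuous_sum.
rewrite ip_sumr//; apply: eq_bigr => j _; rewrite ipC ip_sumr//.
rewrite (bigD1 j)//= big1 => [|i ij]; first by rewrite os eqxx mulr1; ring.
by rewrite os eq_sym (_ : (i == j :> nat) = false) ?mulr0//; exact/negbTE.
Qed.

(** Pythagoras for the orthogonal projection; both Bessel and Parseval come from it. *)
Lemma ip_remainder f n (s : nat -> graph_fun G) :
  edgewise_continuous f -> (forall j, edgewise_continuous (s j)) ->
  (forall i j, ip (s i) (s j) = (i == j)%:R) ->
  let r : graph_fun G := fun e x => f e x - \sum_(j < n) ip f (s j) * s j e x in
  ip r r = ip f f - \sum_(j < n) ip f (s j) ^+ 2.
Proof.
move=> cf cs os r.
pose u : graph_fun G := fun e x => \sum_(j < n) ip f (s j) * s j e x.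
have cu : edgewise_continuous u.
  exact: (edgewise_continuous_sum n (fun j => ip f (s j)) s cs).
pose r' : graph_fun G := fun e x => f e x + (-1) * u e x.
have cr : edgewise_continuous r' by exact: (edgewise_continuous_lin f u).
have -> : ip r r = ip r' r' by apply: eq_ip => e x _; rewrite /r /r' mulN1r.
have uu : ip u u = \sum_(j < n) ip f (s j) ^+ 2.
  rewrite (ip_sum_sum n (fun j => ip f (s j)) s (fun=> 1))//; last first.
    by move=> i j; rewrite mul1r.
  by apply: eq_bigr => j _; rewrite mul1r.
have fu : ip f u = \sum_(j < n) ip f (s j) ^+ 2.
  by rewrite (ip_sumr f n (fun j => ip f (s j)))//; apply: eq_bigr => j _; rewrite expr2.
rewrite ip_linr// (ipC r' f) (ipC r' u) !ip_linr// (ipC u f) uu fu; ring.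
Qed.

Definition on_edge e (h : R -> R) : graph_fun G :=
  fun e' x => if e' == e then h x else 0.

Lemma edgewise_continuous_on_edge e h : continuous h ->
  edgewise_continuous (on_edge e h).
Proof.
by move=> ch e'; rewrite /on_edge; case: eqP => // _; exact: cst_continuous.
Qed.

Lemma ip_on_edge e (h : R -> R) u :
  ip (on_edge e h) u = \int[mu]_(x in `[0, len e]) (h x * u e x).
Proof.
by rewrite ipC ip_edge; apply: eq_Rintegral => x _; rewrite mulrC.
Qed.

Lemma edgewise_continuous_inL2 u : edgewise_continuous u -> inL2 u.
Proof.
by move=> cu e; apply: continuous_L2; exact: continuous_subspaceT.
Qed.

(** By Pythagoras the squared norm of the Fourier remainder is [ip f f] minus the partial sum, and
    completeness sends it to 0. [s] supplies globally continuous representatives of [psi]. *)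
Lemma parseval f (psi s : nat -> graph_fun G) :
  orthonormal_basis psi ->
  (forall j e x, 0 <= x <= len e -> psi j e x = s j e x) ->
  (forall j, edgewise_continuous (s j)) -> edgewise_continuous f ->
  (\sum_(j < n) ip f (s j) ^+ 2) @[n --> \oo] --> ip f f.
Proof.
move=> [_ ons tot] ps cs cf.
have ons' i j : ip (s i) (s j) = (i == j)%:R.
  by rewrite -ons; apply: eq_ip => e x xe; rewrite ps.
have /= := tot f (edgewise_continuous_inL2 _ cf).
have E : (fun n : nat => ip f f - \sum_(j < n) ip f (s j) ^+ 2) =
  (fun n : nat => let r : graph_fun G := fun e x =>
     f e x - \sum_(j < n) ip f (psi j) * psi j e x in ip r r).
  apply/funext => n; rewrite /= -ip_remainder//.
  apply: eq_ip => e x xe; congr (_ - _); apply: eq_bigr => j _;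
    by rewrite ps//; congr (_ * _); apply: eq_ip => // *; rewrite ps.
rewrite -E {E}.
move=> h.
have : ip f f - (ip f f - \sum_(j < n) ip f (s j) ^+ 2) @[n --> \oo] --> ip f f - 0.
  by apply: cvgB => //; exact: cvg_cst.
rewrite subr0 (_ : (fun n : nat => ip f f - _) =
  fun n : nat => \sum_(j < n) ip f (s j) ^+ 2)//.
by apply/funext => n; ring.
Qed.

End inner_product.

(** * Counting eigenvalues *)

Section counting.
Context {R : realType}.
Notation mu := (@lebesgue_measure R).

Lemma Rintegral_cat (f : R -> R) (p q : R) : continuous f -> 0 <= p <= q ->
  \int[mu]_(x in `[0, q]) f x =
  \int[mu]_(x in `[0, p]) f x + \int[mu]_(x in `[p, q]) f x.
Proof.
move=> cf /andP[p0 pq].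
rewrite -Rintegral_itv_obnd_cbnd; last first.
  apply: integrableS (integrable_segment f p q cf) => //.
  exact: subset_itv_oc_cc.
rewrite -(@Rintegral_itvB _ _ (BLeft 0)) ?bnd_simp//.
  by rewrite addrC subrK.
exact: integrable_segment.
Qed.

(** The cells have length [l / K] with [w * l / K < pi], and [u] vanishes at their ends; the
    inequalities on the cells are added one after another. *)
Lemma poincare_dirichlet_grid (u du : R -> R) (w l : R) (K : nat) :
  0 < w -> 0 <= l -> (0 < K)%N -> w * l < pi * K%:R ->
  (forall x : R, is_derive x 1 u (du x)) -> continuous du ->
  (forall i, (i <= K)%N -> u (l * (i%:R / K%:R)) = 0) ->
  w ^+ 2 * \int[mu]_(x in `[0, l]) (u x * u x) <=
  \int[mu]_(x in `[0, l]) (du x * du x).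
Proof.
move=> w0 l0 K0 wl hu cdu u0.
have KR : 0 < K%:R :> R by rewrite ltr0n.
have cu : continuous u by move=> x; exact: is_derive_continuous (hu x).
suff H i : (i <= K)%N ->
    w ^+ 2 * \int[mu]_(x in `[0, l * (i%:R / K%:R)]) (u x * u x) <=
    \int[mu]_(x in `[0, l * (i%:R / K%:R)]) (du x * du x).
  by have := H K (leqnn K); rewrite divff ?gt_eqF// mulr1.
elim: i => [_|i ih iK].
  by rewrite mul0r mulr0 set_itv1 !Rintegral_set1 mulr0.
have pq : 0 <= l * (i%:R / K%:R) <= l * (i.+1%:R / K%:R).
  rewrite mulr_ge0 ?divr_ge0//= ler_wpM2l// ler_pM2r ?invr_gt0//.
  by rewrite ler_nat.
rewrite !(Rintegral_cat _ _ _ _ pq); try exact: continuous_mul.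
rewrite mulrDr lerD ?ih// 1?ltnW//.
case/andP: pq => _ pq.
apply: poincare_dirichlet => //; [|by apply: u0; exact: ltnW|exact: u0].
rewrite -mulrBr -mulrBl -natrB// subSnn mul1r mulrA.
by rewrite ltr_pdivrMr.
Qed.

Context {G : metricGraph R}.

(* The vanishing conditions on a grid of mesh less than [pi / w] are fewer than
   [w * L / pi + 2 * #edges]; with more functions than conditions some
   combination [u] vanishes on the grid, and then [w ^ 2 * |u| ^ 2 <= |u'| ^ 2]. *)
Lemma spectral_count (A B : nat -> edge G -> R) (s : nat -> R) (n : nat) (w : R) :
  let S (j : nat) : graph_fun G := fun e x => sinusoid (A j e) (B j e) (s j) x in
  let D (j : nat) : graph_fun G :=
    fun e x => sinusoid (s j * B j e) (- (s j * A j e)) (s j) x in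
  (forall i j, ip (S i) (S j) = (i == j)%:R) ->
  (forall i j, ip (D i) (D j) = s i ^+ 2 * (i == j)%:R) ->
  (forall j, 0 <= s j) -> 0 < w -> (forall j, (j < n)%N -> s j < w) ->
  n%:R <= w * total_length G / pi + 2 * #|edge G|%:R.
Proof.
(* The empty family is split off because [inord] below needs a nonempty index type. *)
case: n => [|n] S D hS hD s0 w0 sw.
  have L0 : 0 <= total_length G by apply: sumr_ge0 => e _; exact/ltW/len_gt0.
  by rewrite addr_ge0 ?divr_ge0 ?pi_ge0 ?mulr_ge0// ltW.
have cS j : edgewise_continuous (S j) by move=> e; exact: continuous_sinusoid.
have cD j : edgewise_continuous (D j) by move=> e; exact: continuous_sinusoid.
(* The least integer above [w * len e / pi]: the mesh is below [pi / w], and with both ends there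
   are [K e + 1], at most [w * len e / pi + 2], grid points. *)
pose K e := (Num.truncn (w * len (m := G) e / pi)).+1.
pose T := {e : edge G & 'I_(K e).+1}.
have cardT : #|{: T}|%:R <= w * total_length G / pi + 2 * #|edge G|%:R.
  rewrite card_tagged sumnE big_map big_enum/= natr_sum.
  rewrite /total_length mulr_sumr mulr_suml -sum1_card natr_sum mulr_sumr.
  rewrite -big_split/= ler_sum// => e _; rewrite card_ord /K.
  rewrite -[X in X%:R]addn2 natrD mulr1 lerD2r truncn_le//.
  by rewrite divr_ge0 ?pi_ge0// mulr_ge0 ?ltW// len_gt0.
apply: le_trans cardT; rewrite ler_nat leqNgt; apply/negP => cardT.
pose pt (t : T) : R := len (tag t) * ((tagged t : nat)%:R / (K (tag t))%:R).
(* Rows are eigenfunctions and columns are grid points; with more rows than columns the left kernel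
   contains a nonzero [c]. *)
pose M : 'M[R]_(n.+1, #|{: T}|) :=
  \matrix_(j, k) S j (tag (enum_val k)) (pt (enum_val k)).
have : kermx M != 0.
  rewrite -mxrank_eq0 mxrank_ker subn_eq0 -ltnNge.
  by rewrite (leq_ltn_trans (rank_leq_col M)).
move=> /rowV0Pn[c /sub_kermxP cM cN0].
pose d (j : nat) := c 0 (inord j).
pose u : graph_fun G := fun e x => \sum_(j < n.+1) d j * S j e x.
pose du : graph_fun G := fun e x => \sum_(j < n.+1) d j * D j e x.
have hu e (x : R) : is_derive x 1 (u e) (du e x).
  rewrite /u /du; elim: n.+1 => [|m ih].
    rewrite (_ : (fun x => _) = (fun=> 0)) ?big_ord0; first exact: is_derive_cst.
    by apply/funext => y; rewrite big_ord0.
  rewrite (_ : (fun x => _) = (fun x => \sum_(j < m) d j * S j e x + d m * S m e x)).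
    rewrite big_ord_recr/=; apply: is_derive_add => //.
    by apply: is_derive_scale; exact: is_derive_sinusoid.
  by apply/funext => y; rewrite big_ord_recr.
have cdu e : continuous (du e) by exact: (edgewise_continuous_sum n.+1 d D cD).
have u0 e (i : nat) : (i <= K e)%N -> u e (len e * (i%:R / (K e)%:R)) = 0.
  move=> iK.
  pose t : T := Tagged (fun e => 'I_(K e).+1) (Ordinal (iK : (i < (K e).+1)%N)).
  have := congr1 (fun m : 'rV_#|{: T}| => m 0 (enum_rank t)) cM.
  rewrite !mxE => h; rewrite -[RHS]h; apply: eq_bigr => j _.
  by rewrite mxE enum_rankK /d inord_val.
have : w ^+ 2 * ip u u <= ip du du.
  rewrite /ip mulr_sumr ler_sum// => e _.
  apply: (poincare_dirichlet_grid (u e) (du e) w (len e) (K e)) => //.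
  - exact/ltW/len_gt0.
  - by rewrite [ltRHS]mulrC -ltr_pdivrMr ?pi_gt0// truncnS_gt.
  - by move=> i; exact: u0.
(* By orthogonality the inequality says that the sum of [(w ^ 2 - s j ^ 2) * d j ^ 2] is at most 0.
   Each factor [w ^ 2 - s j ^ 2] is positive, so every [d j] vanishes, against the choice of [c]. *)
rewrite (ip_sum_sum n.+1 d S (fun=> 1))//; last by move=> i j; rewrite mul1r.
rewrite (ip_sum_sum n.+1 d D (fun j => s j ^+ 2))// mulr_sumr -subr_le0 -sumrB.
move=> le0.
have ge0 (j : 'I_n.+1) : 0 <= w ^+ 2 * (1 * d j ^+ 2) - s j ^+ 2 * d j ^+ 2.
  rewrite mul1r -mulrBl mulr_ge0 ?sqr_ge0// subr_ge0 ler_sqr ?nnegrE ?s0 ?(ltW w0)//.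
  by rewrite ltW// sw.
have sum0 : \sum_(j < n.+1) (w ^+ 2 * (1 * d j ^+ 2) - s j ^+ 2 * d j ^+ 2) == 0.
  by apply/eqP/le_anti; rewrite le0/=; apply: sumr_ge0 => j _; exact: ge0.
move: sum0; rewrite psumr_eq0; last by move=> j _; exact: ge0.
move=> /allP d0.
case/negP: cN0; apply/eqP/rowP => j; rewrite mxE.
have /eqP := d0 j (mem_index_enum _).
rewrite mul1r -mulrBl => /eqP; rewrite mulf_eq0 => /orP[|].
  by rewrite gt_eqF// subr_gt0 ltr_sqr ?nnegrE ?s0 ?(ltW w0)// sw.
by rewrite sqrf_eq0 /d inord_val => /eqP.
Qed.

End counting.

(** * Fourier coefficients of sinusoids *)

Section cosines.
Context {R : realType}.
Notation mu := (@lebesgue_measure R).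

Lemma sin_pi_nat (n : nat) : sin (pi * n%:R) = 0 :> R.
Proof.
rewrite mulr_natr -[pi *+ n]add0r (alternatingn (@sinDpi R)).
by rewrite sin0 mulr0.
Qed.

(** Cauchy-Schwarz, through the Lagrange identity. *)
Lemma sinusoid_sqr_le (A B s x : R) : sinusoid A B s x ^+ 2 <= A ^+ 2 + B ^+ 2.
Proof.
rewrite -subr_ge0 -[X in X - _]mulr1 -(cos2Dsin2 (s * x)).
have -> : (A ^+ 2 + B ^+ 2) * (cos (s * x) ^+ 2 + sin (s * x) ^+ 2) -
  sinusoid A B s x ^+ 2 = (A * sin (s * x) - B * cos (s * x)) ^+ 2.
  by rewrite /sinusoid; ring.
exact: sqr_ge0.
Qed.

(** In Green's identity the factor [s ^ 2 - t ^ 2] is at least [eps * s ^ 2] by the frequency gap,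
    while the boundary terms are of order [s] only. *)
Lemma Rintegral_cos_sinusoid_decay (A B s t l eps : R) :
  0 <= l -> sin (t * l) = 0 -> 0 < s -> 0 < eps -> 0 <= t <= (1 - eps) * s ->
  (\int[mu]_(x in `[0, l]) (cos (t * x) * sinusoid A B s x)) ^+ 2 <=
  4 * (A ^+ 2 + B ^+ 2) / (eps ^+ 2 * s ^+ 2).
Proof.
move=> l0 stl s0 e0 /andP[t0 ts].
have := Rintegral_cos_sinusoid A B s t l l0 stl.
set X := \int[mu]_(x in _) _; set D := sinusoid (s * B) _ s l => hX.
have hD : D ^+ 2 <= s ^+ 2 * (A ^+ 2 + B ^+ 2).
  apply: le_trans (sinusoid_sqr_le _ _ _ _) _.
  by rewrite le_eqVlt; apply/orP; left; apply/eqP; ring.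
have hst : eps * s ^+ 2 <= s ^+ 2 - t ^+ 2.
  have h1 : t ^+ 2 <= ((1 - eps) * s) ^+ 2.
    by rewrite ler_sqr ?nnegrE// (le_trans t0).
  (* The bounds on [t] force [eps <= 1], hence [1 - (1 - eps) ^ 2 >= eps]. *)
  have e1 : 0 <= 1 - eps by rewrite -(pmulr_lge0 _ s0) (le_trans t0).
  have h2 : 0 <= (eps * (1 - eps)) * s ^+ 2.
    by rewrite mulr_ge0 ?sqr_ge0// mulr_ge0// ltW.
  by nra.
have hc : cos (t * l) ^+ 2 <= 1 by have := cos2Dsin2 (t * l); nra.
have hY : ((s ^+ 2 - t ^+ 2) * X) ^+ 2 <= 4 * (s ^+ 2 * (A ^+ 2 + B ^+ 2)).
  rewrite hX; set c := cos _ in hc *.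
  have h1 : (c * D) ^+ 2 <= s ^+ 2 * (A ^+ 2 + B ^+ 2).
    rewrite exprMn; apply: le_trans hD.
    by rewrite ler_piMl// sqr_ge0.
  have h2 : (s * B) ^+ 2 <= s ^+ 2 * (A ^+ 2 + B ^+ 2).
    by rewrite exprMn ler_wpM2l ?sqr_ge0// lerDr sqr_ge0.
  (* This square gives [(x - y) ^ 2 <= 2 * (x ^ 2 + y ^ 2)] for the two boundary terms, whence the
     constant 4. *)
  have h3 : 0 <= (s * B + c * D) ^+ 2 by exact: sqr_ge0.
  by nra.
rewrite ler_pdivlMr ?mulr_gt0 ?exprn_gt0//.
have s2 : 0 < s ^+ 2 by exact: exprn_gt0.
rewrite -(ler_pM2r s2).
have -> : 4 * (A ^+ 2 + B ^+ 2) * s ^+ 2 = 4 * (s ^+ 2 * (A ^+ 2 + B ^+ 2)) by ring.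
apply: le_trans hY; rewrite exprMn.
have -> : X ^+ 2 * (eps ^+ 2 * s ^+ 2) * s ^+ 2 = (eps * s ^+ 2) ^+ 2 * X ^+ 2 by ring.
rewrite ler_wpM2r ?sqr_ge0// ler_sqr ?nnegrE//.
- by rewrite mulr_ge0 ?ltW.
- by apply: le_trans hst; rewrite mulr_ge0 ?ltW.
Qed.

(** In the exact formula each of the two boundary terms is at most [s * (A ^ 2 + B ^ 2)]; dividing
    by [2 * s ^ 2] leaves the stated error. *)
Lemma Rintegral_sinusoid_sqr_approx (A B s l : R) : 0 <= l -> 0 < s ->
  `|\int[mu]_(x in `[0, l]) (sinusoid A B s x * sinusoid A B s x) -
    (A ^+ 2 + B ^+ 2) * l / 2| <= (A ^+ 2 + B ^+ 2) / s.
Proof.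
move=> l0 s0; have := Rintegral_sinusoid_sqr A B s l l0.
set m := \int[mu]_(x in _) _; set D := sinusoid (s * B) _ s l.
set u := sinusoid A B s l; set w := A ^+ 2 + B ^+ 2 => hm.
have hD : D ^+ 2 <= s ^+ 2 * w.
  apply: le_trans (sinusoid_sqr_le _ _ _ _) _.
  by rewrite le_eqVlt; apply/orP; left; apply/eqP; rewrite /w; ring.
have hu : u ^+ 2 <= w by exact: sinusoid_sqr_le.
have s2 : 0 < 2 * s ^+ 2 by rewrite mulr_gt0// exprn_gt0.
rewrite -(ler_pM2l s2) -{1}(gtr0_norm s2) -normrM.
have -> : 2 * s ^+ 2 * (m - w * l / 2) = A * (s * B) - u * D.
  by rewrite mulrBr hm; field.
have -> : 2 * s ^+ 2 * (w / s) = 2 * (s * w) by field; rewrite gt_eqF.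
have h1 : `|A * (s * B)| <= s * w.
  have k1 : 0 <= s * (A + B) ^+ 2 by rewrite mulr_ge0 ?sqr_ge0 ?ltW.
  have k2 : 0 <= s * (A - B) ^+ 2 by rewrite mulr_ge0 ?sqr_ge0 ?ltW.
  have k3 : 0 <= s * A ^+ 2 by rewrite mulr_ge0 ?sqr_ge0 ?ltW.
  have k4 : 0 <= s * B ^+ 2 by rewrite mulr_ge0 ?sqr_ge0 ?ltW.
  by rewrite ler_norml /w; apply/andP; split; nra.
have h2 : `|u * D| <= s * w.
  have k1 : 0 <= (s * u - D) ^+ 2 by exact: sqr_ge0.
  have k2 : 0 <= (s * u + D) ^+ 2 by exact: sqr_ge0.
  have k3 : s ^+ 2 * u ^+ 2 <= s ^+ 2 * w by rewrite ler_wpM2l ?sqr_ge0.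
  by rewrite ler_norml; apply/andP; split; rewrite -(ler_pM2l s0); lra.
by apply: le_trans (ler_normB _ _) _; lra.
Qed.

(** For [s * l >= 4] the error is at most half of the main term, so the mass is at least
    [(A ^ 2 + B ^ 2) * l / 4]. *)
Lemma weight_le (A B s l : R) : 0 < l -> 4 <= s * l ->
  \int[mu]_(x in `[0, l]) (sinusoid A B s x * sinusoid A B s x) <= 1 ->
  A ^+ 2 + B ^+ 2 <= 4 / l.
Proof.
move=> l0 sl m1.
have s0 : 0 < s by rewrite -(pmulr_lgt0 _ l0) (lt_le_trans _ sl).
have := Rintegral_sinusoid_sqr_approx A B s l (ltW l0) s0.
set m := \int[mu]_(x in _) _ in m1 *; set w := A ^+ 2 + B ^+ 2.
rewrite ler_norml => /andP[h _].
have w0 : 0 <= w by rewrite addr_ge0 ?sqr_ge0.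
have h2 : w / s <= w * l / 4.
  by rewrite ler_pdivrMr//; nra.
by rewrite ler_pdivlMr//; lra.
Qed.

(** Telescoping: [1 / (j + 1) ^ 2 <= 1 / j - 1 / (j + 1)]. *)
Lemma sum_inv_sqr_le (N n : nat) : (0 < N)%N -> (N <= n)%N ->
  \sum_(N <= j < n) (j.+1%:R ^+ 2)^-1 <= N%:R^-1 - n%:R^-1 :> R.
Proof.
move=> N0; elim: n => [|n ih]; first by rewrite leqn0 => /eqP N00; rewrite N00 in N0.
rewrite leq_eqVlt => /predU1P[->|]; first by rewrite big_geq// subrr.
rewrite ltnS => Nn; rewrite big_nat_recr//=.
apply: le_trans (lerD (ih Nn) (lexx _)) _.
have n0 : 0 < n%:R :> R by rewrite ltr0n (leq_trans N0).
have n1 : 0 < n.+1%:R :> R by rewrite ltr0n.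
have e1 : n.+1%:R = n%:R + 1 :> R by rewrite natr1.
suff : (n.+1%:R ^+ 2)^-1 <= n%:R^-1 - n.+1%:R^-1 :> R.
  by rewrite -addrA lerD2l addrC lerBlDr addrC.
have -> : n%:R^-1 - n.+1%:R^-1 = (n%:R * n.+1%:R)^-1 :> R.
  rewrite e1; field; rewrite -e1 !gt_eqF//.
rewrite lef_pV2 ?posrE ?mulr_gt0 ?exprn_gt0// expr2.
by rewrite ler_wpM2r ?(ltW n1)// ler_nat.
Qed.

(* The terms with [j < N] are bounded by [m j] and those with [j >= N] by the
   decay [q / (j + 1) ^ 2]. *)
Lemma parseval_truncation (x : nat -> nat -> R) (m : nat -> R) (M N : nat) (q : R) :
  (forall k, (\sum_(j < n) x k j) @[n --> \oo] --> (1 : R)) ->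
  (forall j, \sum_(k < M) x k j <= m j) ->
  (0 < N)%N -> 0 <= q ->
  (forall j k, (N <= j)%N -> (k < M)%N -> x k j <= q / j.+1%:R ^+ 2) ->
  M%:R <= \sum_(j < N) m j + M%:R * (q / N%:R).
Proof.
move=> x1 xm N0 q0 xq.
(* The finite sum over [k] commutes with the limit; it remains to bound the partial sums uniformly
   in [n >= N]. *)
have cM : (\sum_(k < M) \sum_(j < n) x k j) @[n --> \oo] --> (M%:R : R).
  elim: M {xm xq} => [|M ih].
    by under eq_fun do rewrite big_ord0; exact: cvg_cst.
  under eq_fun do rewrite big_ord_recr/=.
  by rewrite -natr1; apply: cvgD.
rewrite -[leLHS](cvg_lim (@Rhausdorff R) cM); apply: limr_le.
  by apply/cvg_ex; exists M%:R.
near=> n; have Nn : (N <= n)%N by near: n; exact: nbhs_infty_ge.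
rewrite exchange_big/= -(big_mkord xpredT (fun j => \sum_(k < M) x k j)).
rewrite (big_cat_nat (n := N))//= -(big_mkord xpredT m).
apply: lerD; first by apply: ler_sum => j _; exact: xm.
apply: (@le_trans _ _ (\sum_(N <= j < n) M%:R * q * (j.+1%:R ^+ 2)^-1)).
  apply: ler_sum_nat => j /andP[Nj _].
  apply: (@le_trans _ _ (\sum_(k < M) q / j.+1%:R ^+ 2)).
    by apply: ler_sum => k _; exact: xq.
  rewrite sumr_const card_ord -[leLHS]mulr_natl mulrA.
  by [].
rewrite -mulr_sumr mulrA ler_wpM2l ?mulr_ge0//.
apply: le_trans (sum_inv_sqr_le _ _ N0 Nn) _.
by rewrite lerBlDr lerDl invr_ge0.
Unshelve. all: by end_near. Qed.

End cosines.

(** * The spectral family *)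

Section spectral_family.
Context {R : realType} {G : metricGraph R}.
Notation mu := (@lebesgue_measure R).

Lemma ip_ae_eq (u u' v v' : graph_fun G) :
  inL2 u -> inL2 v -> inL2 u' -> inL2 v' ->
  (forall e, {ae mu, forall x, x \in `[0, len e] -> u e x = u' e x}) ->
  (forall e, {ae mu, forall x, x \in `[0, len e] -> v e x = v' e x}) ->
  ip u v = ip u' v'.
Proof.
have ae_filter := ae_filter_ringOfSetsType mu.
have mp (f g : graph_fun G) (e : edge G) : inL2 f -> inL2 g ->
    measurable_fun (`[0, len e] : set (measurableTypeR R)) (fun x => f e x * g e x).
  move=> lf lg.
  have h := integrable_L2_mul _ _ _ (measurable_itv _) (lf e) (lg e).
  by apply/measurable_EFinP; exact: measurable_int h.
move=> lu lv lu' lv' uu' vv'; apply: eq_bigr => e _.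
apply: Rintegral_ae_eq; [exact: measurable_itv|exact: mp|exact: mp|].
by apply: filterS2 (uu' e) (vv' e) => x h k xe; rewrite h// k.
Qed.

(** Replaces the eigenfunctions by explicit sinusoids on the whole line. The derivatives inherit
    orthogonality from the weak equation of one eigenfunction tested against another. *)
Lemma spectral_family (psi : nat -> graph_fun G) (lambda sigma : nat -> R) :
  orthonormal_basis psi ->
  (forall j, eigenfunction (lambda j) (psi j)) ->
  (forall j, 0 <= sigma j) -> (forall j, lambda j = sigma j ^+ 2) ->
  exists A B : nat -> edge G -> R,
  let S (j : nat) : graph_fun G :=
    fun e x => sinusoid (A j e) (B j e) (sigma j) x in
  let D (j : nat) : graph_fun G :=
    fun e x => sinusoid (sigma j * B j e) (- (sigma j * A j e)) (sigma j) x in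
  [/\ forall j e x, 0 <= x <= len e -> psi j e x = S j e x,
      forall i j, ip (S i) (S j) = (i == j)%:R
    & forall i j, ip (D i) (D j) = sigma i ^+ 2 * (i == j)%:R].
Proof.
move=> [lpsi ons _] heig s0 hl.
have h j : exists AB : (edge G -> R) * (edge G -> R),
    (forall e x, 0 <= x <= len e -> psi j e x = sinusoid (AB.1 e) (AB.2 e) (sigma j) x) /\
    exists2 du, H1_deriv (psi j) du &
      (forall v dv, H1_deriv v dv ->
        ip du dv = ip (fun e x => sigma j ^+ 2 * psi j e x) v) /\
      forall e, {ae mu, forall x, x \in `[0, len e] ->
        du e x = sinusoid (sigma j * AB.2 e) (- (sigma j * AB.1 e)) (sigma j) x}.
  have := heig j; rewrite hl => /(eigenfunction_sinusoid _ _ (s0 j))[A [B AB]].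
  by exists (A, B).
have {h} [AB hAB] := choice h.
exists (fun j => (AB j).1), (fun j => (AB j).2) => S D.
have pS j e x : 0 <= x <= len e -> psi j e x = S j e x by have [+ _] := hAB j; exact.
have hS i j : ip (S i) (S j) = (i == j)%:R.
  by rewrite -ons; apply: eq_ip => e x xe; rewrite pS.
have cS j : edgewise_continuous (S j) by move=> e; exact: continuous_sinusoid.
have cD j : edgewise_continuous (D j) by move=> e; exact: continuous_sinusoid.
split=> // i j.
have [_ [du hdu [weak aedu]]] := hAB i.
have [_ [dv hdv [_ aedv]]] := hAB j.
rewrite -(@ip_ae_eq du _ dv); [|by case: hdu|by case: hdv|
  exact: edgewise_continuous_inL2|exact: edgewise_continuous_inL2|exact: aedu|
  exact: aedv].
rewrite (weak _ _ hdv).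
(* The zero summand, rewritten to a plain [0] below, gives the expression the shape that [ip_linr]
   expects. *)
rewrite (@eq_ip _ _ _ (fun e x => 0 * S i e x + sigma i ^+ 2 * S i e x) _ (S j)).
- rewrite ipC (@eq_ip _ _ _ (S j) _ (fun e x => 0 + sigma i ^+ 2 * S i e x))//.
    rewrite ip_linr//; last by move=> e; exact: cst_continuous.
    rewrite (ipC (S j) (S i)) hS /ip big1 ?add0r// => e _.
    under eq_Rintegral do rewrite mulr0.
    by rewrite Rintegral_cst ?mul0r//; exact: measurable_itv.
  by move=> e x _; rewrite mul0r.
- by move=> e x xe; rewrite mul0r add0r pS.
- by move=> e x xe; rewrite pS.
Qed.

End spectral_family.

(** * Edge masses and linear growth of the frequencies *)

Section edge_mass.
Context {R : realType} {G : metricGraph R}.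
Notation mu := (@lebesgue_measure R).
Variables (psi : nat -> graph_fun G) (lambda sigma : nat -> R).
Hypothesis hbasis : orthonormal_basis psi.
Hypothesis heig : forall j, eigenfunction (lambda j) (psi j).
Hypothesis hsigma : forall j, 0 <= sigma j.
Hypothesis hlambda : forall j, lambda j = sigma j ^+ 2.
Hypothesis hord : forall i j : nat, (i <= j)%N -> lambda i <= lambda j.

Definition edge_mass (e : edge G) (j : nat) : R :=
  \int[mu]_(x in `[0, len e]) (psi j e x * psi j e x).

Lemma edge_mass_sum j : \sum_(e : edge G) edge_mass e j = 1.
Proof. by have [_ h _] := hbasis; have := h j j; rewrite eqxx. Qed.

Lemma edge_mass_ge0 e j : 0 <= edge_mass e j.
Proof. by apply: Rintegral_ge0 => x _; rewrite -expr2 sqr_ge0. Qed.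

Lemma edge_mass_le1 e j : edge_mass e j <= 1.
Proof.
rewrite -(edge_mass_sum j) (bigD1 e)//= lerDl.
by apply: sumr_ge0 => e' _; exact: edge_mass_ge0.
Qed.

Lemma sigma_le i j : (i <= j)%N -> sigma i <= sigma j.
Proof.
by move=> /hord; rewrite !hlambda ler_sqr ?nnegrE.
Qed.

(** The counting bound for the [j + 1] functions of index at most [j]. It needs [w] strictly above
    [sigma j], so [w] is taken to [sigma j] in the limit. *)
Lemma sigma_ge j :
  pi * (j.+1%:R - 2 * #|edge G|%:R) <= sigma j * total_length G.
Proof.
have [A [B /= [_ hS hD]]] := spectral_family _ _ _ hbasis heig hsigma hlambda.
have L0 : 0 <= total_length G by apply: sumr_ge0 => e _; exact/ltW/len_gt0.
have h w : sigma j < w -> pi * (j.+1%:R - 2 * #|edge G|%:R) <= w * total_length G.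
  move=> jw; rewrite mulrC -ler_pdivlMr ?pi_gt0// lerBlDr.
  apply: (spectral_count A B sigma j.+1 w hS hD hsigma).
    exact: le_lt_trans (hsigma j) jw.
  by move=> i; rewrite ltnS => /sigma_le /le_lt_trans; exact.
apply/ler_addgt0Pr => d d0.
(* The added 1 keeps the divisor positive even for a graph without edges. *)
have L1 : 0 < total_length G + 1 by rewrite ltr_wpDl.
apply: le_trans (h (sigma j + d / (total_length G + 1)) _) _.
  by rewrite ltrDl divr_gt0.
rewrite mulrDl lerD2l mulrAC ler_pdivrMr// ler_wpM2l ?ltW//.
by rewrite ltrDl.
Qed.

End edge_mass.

(** * Lower bound on the mass of an edge *)

Section neumann_modes.
Context {R : realType} {G : metricGraph R}.
Notation mu := (@lebesgue_measure R).
Variable e : edge G.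

(** Neumann frequencies of the interval, starting at [pi / len e]: without the constant mode all
    frequencies are positive and one normalisation [sqrt (2 / len e)] serves for all. *)
Definition mode_freq (k : nat) : R := pi * k.+1%:R / len e.

Definition mode (k : nat) : graph_fun G :=
  on_edge e (fun x => Num.sqrt (2 / len e) * cos (mode_freq k * x)).

Lemma mode_freqK k : mode_freq k * len e = pi * k.+1%:R.
Proof. by rewrite /mode_freq divfK// gt_eqF// len_gt0. Qed.

Lemma continuous_cosM (t : R) : continuous (fun x => cos (t * x)).
Proof.
rewrite (_ : (fun x => _) = sinusoid 1 0 t); first exact: continuous_sinusoid.
by apply/funext => x; rewrite /sinusoid mul1r mul0r addr0.
Qed.

Lemma edgewise_continuous_mode k : edgewise_continuous (mode k).
Proof.
apply: edgewise_continuous_on_edge; apply: continuous_mul.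
  exact: cst_continuous.
exact: continuous_cosM.
Qed.

Lemma ip_mode k (u : graph_fun G) : edgewise_continuous u -> ip (mode k) u =
  Num.sqrt (2 / len e) * \int[mu]_(x in `[0, len e]) (cos (mode_freq k * x) * u e x).
Proof.
move=> cu; rewrite ip_on_edge -RintegralZl//.
  by apply: eq_Rintegral => x _; rewrite mulrA.
by apply: integrable_segment; apply: continuous_mul => //; exact: continuous_cosM.
Qed.

(** For distinct frequencies both boundary terms of Green's identity vanish, while the factor
    [s ^ 2 - t ^ 2] does not. *)
Lemma ip_mode_mode i j : ip (mode i) (mode j) = (i == j)%:R.
Proof.
have l0 := len_gt0 e.
have sl k : sin (mode_freq k * len e) = 0 by rewrite mode_freqK sin_pi_nat.
have f0 k : 0 < mode_freq k by rewrite divr_gt0 ?mulr_gt0 ?pi_gt0.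
rewrite ip_mode; last exact: edgewise_continuous_mode.
under eq_Rintegral do rewrite /mode /on_edge eqxx mulrCA.
rewrite RintegralZl//; last first.
  by apply: integrable_segment; apply: continuous_mul; exact: continuous_cosM.
rewrite mulrA -expr2 sqr_sqrtr ?divr_ge0 ?ltW//.
have [<-|ij] := eqVneq i j.
  rewrite Rintegral_cos_sqr ?ltW// ?gt_eqF//; transitivity (1 : R) => //.
  by field; rewrite gt_eqF.
rewrite [X in _ * X](_ : _ = 0) ?mulr0//.
have := Rintegral_cos_sinusoid 1 0 (mode_freq j) (mode_freq i) (len e) (ltW l0) (sl i).
rewrite {2}/sinusoid sl !(mulr0, mul0r, addr0, oppr0) => /eqP.
rewrite mulf_eq0 => /orP[|/eqP h].
  rewrite subr_eq0 eqrXn2 ?ltW// => /eqP /(congr1 (fun x => x * len e)).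
  rewrite !mode_freqK => /mulfI /eqP; rewrite gt_eqF ?pi_gt0//.
  move=> /(_ isT); rewrite eqr_nat eqSS => /eqP ji.
  by rewrite ji eqxx in ij.
rewrite -[RHS]h; apply: eq_Rintegral => x _.
by rewrite /sinusoid mul1r mul0r addr0.
Qed.

(** Bessel's inequality for the restriction of [s] to [e], extended by zero. *)
Lemma bessel_mode (s : graph_fun G) M : edgewise_continuous s ->
  \sum_(k < M) ip (mode k) s ^+ 2 <=
  \int[mu]_(x in `[0, len e]) (s e x * s e x).
Proof.
move=> cs; pose f := on_edge e (s e).
have cf : edgewise_continuous f by apply: edgewise_continuous_on_edge; exact: cs.
have fC k : ip f (mode k) = ip (mode k) s.
  rewrite ipC !ip_on_edge; apply: eq_Rintegral => x _.
  by rewrite /f /on_edge eqxx.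
have := ip_remainder f M mode cf edgewise_continuous_mode ip_mode_mode => /= h.
have := ip_ge0 (fun e x => f e x - \sum_(j < M) ip f (mode j) * mode j e x).
rewrite h subr_ge0; under eq_bigr do rewrite fC.
rewrite ip_on_edge; under eq_Rintegral do rewrite /f /on_edge eqxx.
by [].
Qed.

End neumann_modes.

(** * Neumann modes of an edge against the spectral family *)

Section lower_bound.
Context {R : realType} {G : metricGraph R}.
Notation mu := (@lebesgue_measure R).
Variables (psi : nat -> graph_fun G) (lambda sigma : nat -> R).
Hypothesis hbasis : orthonormal_basis psi.
Hypothesis heig : forall j, eigenfunction (lambda j) (psi j).
Hypothesis hsigma : forall j, 0 <= sigma j.
Hypothesis hlambda : forall j, lambda j = sigma j ^+ 2.
Hypothesis hord : forall i j : nat, (i <= j)%N -> lambda i <= lambda j.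

Lemma len_le_total (e : edge G) : len e <= total_length G.
Proof.
rewrite /total_length (bigD1 e)//= lerDl.
by apply: sumr_ge0 => e' _; exact/ltW/len_gt0.
Qed.

Lemma total_length_gt0 (e : edge G) : 0 < total_length G.
Proof. exact: lt_le_trans (len_gt0 e) (len_le_total e). Qed.

(** From this index on the offset [2 * #|edge G|] in [sigma_ge] is at most half of [j + 1]. The edge
    [e] ensures that the total length is positive. *)
Lemma sigma_linear (e : edge G) j : 4 * #|edge G|%:R <= j.+1%:R :> R ->
  pi / (2 * total_length G) * j.+1%:R <= sigma j.
Proof.
have L0 := total_length_gt0 e.
have := sigma_ge _ _ _ hbasis heig hsigma hlambda hord j.
move=> h hj; rewrite mulrAC ler_pdivrMr ?mulr_gt0//.
have h2 : pi * (j.+1%:R * 2^-1) <= pi * (j.+1%:R - 2 * #|edge G|%:R) :> R.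
  by rewrite ler_wpM2l ?pi_ge0//; lra.
have := le_trans h2 h; lra.
Qed.

Lemma edge_mass_lower (e : edge G) (eps : R) : 0 < eps < 1 ->
  exists (C : R) (N0 : nat), forall N, (N0 <= N)%N ->
    (1 - eps) * (len e / total_length G) * N%:R - C <=
    \sum_(j < N) edge_mass psi e j.
Proof.
move=> /andP[eps0 eps1].
have L0 := total_length_gt0 e; set L := total_length G in L0 *.
have l0 := len_gt0 e; set l := len e in l0 *.
have [A [B /= [pS hS hD]]] := spectral_family _ _ _ hbasis heig hsigma hlambda.
pose S (j : nat) : graph_fun G := fun e x => sinusoid (A j e) (B j e) (sigma j) x.
have cS j : edgewise_continuous (S j) by move=> e'; exact: continuous_sinusoid.
have massE j : edge_mass psi e j = \int[mu]_(x in `[0, l]) (S j e x * S j e x).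
  apply: eq_Rintegral => x; rewrite mem_setE in_itv/= => xe.
  by rewrite pS.
pose C0 : R := 2 * #|edge G|%:R.
have C00 : 0 <= C0 by rewrite mulr_ge0.
pose kap : R := pi / (2 * L).
have kap0 : 0 < kap by rewrite divr_gt0 ?pi_gt0 ?mulr_gt0.
(* For [j >= N0], the term [2 * C0] makes [sigma_linear] available, and [4 / (l * kap)] gives
   [sigma j * l >= 4] as [weight_le] requires. *)
pose N0 := (Num.truncn (2 * C0 + 4 / (l * kap))).+1.
(* The product of the squared normalisation [2 / l], the decay constant 4 and the amplitude bound
   [4 / l], with [sigma j] bounded below by [kap * (j + 1)]. *)
pose q := 32 / (l ^+ 2 * eps ^+ 2 * kap ^+ 2).
have q0 : 0 <= q.
  by apply: divr_ge0 => //; apply: mulr_ge0; [apply: mulr_ge0|]; exact: sqr_ge0.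
(* The three losses are the offset in the counting bound, the rounding of [M], and the tail
   [M * q / N] with [M / N <= l / L]. *)
exists ((1 - eps) * (l / L) * C0 + 1 + l / L * q), N0 => N N0N.
have NN0 : 2 * C0 + 4 / (l * kap) < N%:R.
  by apply: lt_le_trans (truncnS_gt _) _; rewrite ler_nat.
have lk0 : 0 < 4 / (l * kap) by rewrite divr_gt0// mulr_gt0.
have Npos : 0 < N%:R :> R by apply: le_lt_trans NN0; lra.
have NgtC : C0 < N%:R by apply: le_lt_trans NN0; lra.
(* Chosen so that the first [M] frequencies are at most [(1 - eps) * pi * (N - C0) / L], hence at
   most [(1 - eps) * sigma j] for every [j >= N]. *)
pose M := Num.truncn ((1 - eps) * (l / L) * (N%:R - C0)).
have X0 : 0 <= (1 - eps) * (l / L) * (N%:R - C0).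
  by rewrite !mulr_ge0 ?subr_ge0 ?ltW// invr_gt0.
have MX : M%:R <= (1 - eps) * (l / L) * (N%:R - C0) by rewrite truncn_le.
have XM : (1 - eps) * (l / L) * (N%:R - C0) < M%:R + 1 by rewrite natr1 truncnS_gt.
have lL0 : 0 <= l / L by rewrite divr_ge0 ?ltW.
have Mle : M%:R <= l / L * N%:R.
  apply: le_trans MX _; rewrite -mulrA.
  have h1 : l / L * (N%:R - C0) <= l / L * N%:R.
    by rewrite ler_wpM2l// gerBl.
  apply: le_trans h1; rewrite ler_piMl//; last by lra.
  by rewrite mulr_ge0// subr_ge0 ltW.
have tail j k : (N <= j)%N -> (k < M)%N ->
    ip (mode e k) (S j) ^+ 2 <= q / j.+1%:R ^+ 2.
  move=> Nj kM.
  have Nj1 : N%:R <= j%:R :> R by rewrite ler_nat.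
  have j1 : j.+1%:R = j%:R + 1 :> R by rewrite natr1.
  have sj : kap * j.+1%:R <= sigma j.
    apply: (sigma_linear e); rewrite j1; move: NN0 Nj1; rewrite /C0; lra.
  have j10 : 0 < j.+1%:R :> R by [].
  have s0 : 0 < sigma j by apply: lt_le_trans sj; rewrite mulr_gt0.
  have s4 : 4 <= sigma j * l.
    rewrite -ler_pdivrMr//; apply: le_trans sj.
    have -> : 4 / l = kap * (4 / (l * kap)).
      by field; rewrite (gt_eqF l0) (gt_eqF kap0).
    by rewrite ler_wpM2l ?(ltW kap0)// j1; lra.
  have wle : A j e ^+ 2 + B j e ^+ 2 <= 4 / l.
    by apply: (weight_le _ _ (sigma j)) => //; rewrite -massE; exact: edge_mass_le1.
  have freq : 0 <= mode_freq e k <= (1 - eps) * sigma j.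
    apply/andP; split; first by rewrite divr_ge0 ?mulr_ge0 ?pi_ge0 ?ltW.
    rewrite /mode_freq -/l ler_pdivrMr//.
    have kM' : k.+1%:R <= (1 - eps) * (l / L) * (N%:R - C0).
      by apply: le_trans MX; rewrite ler_nat.
    have sge : pi * (N%:R - C0) <= sigma j * L.
      apply: le_trans (sigma_ge _ _ _ hbasis heig hsigma hlambda hord j).
      by rewrite ler_wpM2l ?pi_ge0// lerD2r j1; lra.
    apply: (@le_trans _ _ (pi * ((1 - eps) * (l / L) * (N%:R - C0)))).
      by rewrite ler_wpM2l ?pi_ge0.
    have -> : pi * ((1 - eps) * (l / L) * (N%:R - C0)) =
       (1 - eps) * (l / L) * (pi * (N%:R - C0)) by ring.
    have -> : (1 - eps) * sigma j * l = (1 - eps) * (l / L) * (sigma j * L).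
      by field; rewrite gt_eqF.
    by rewrite ler_wpM2l// mulr_ge0// subr_ge0 ltW.
  rewrite ip_mode// exprMn sqr_sqrtr; last by rewrite divr_ge0 ?ltW.
  have dec := Rintegral_cos_sinusoid_decay (A j e) (B j e) (sigma j)
    (mode_freq e k) l eps (ltW l0).
  rewrite mode_freqK sin_pi_nat in dec.
  have {}dec := dec erefl s0 eps0 freq.
  have l20 : 0 <= 2 / l by rewrite divr_ge0 ?ltW.
  have {}dec := ler_wpM2l l20 dec.
  apply: (le_trans dec).
  apply: (@le_trans _ _ (2 / l * (4 * (4 / l) / (eps ^+ 2 * sigma j ^+ 2)))).
    have h1 : 0 <= (eps ^+ 2 * sigma j ^+ 2)^-1.
      by rewrite invr_ge0; apply: mulr_ge0; exact: sqr_ge0.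
    have h2 : 0 <= 2 / l by rewrite divr_ge0 ?ltW.
    by rewrite ler_wpM2l// ler_wpM2r// ler_wpM2l.
  have -> : 2 / l * (4 * (4 / l) / (eps ^+ 2 * sigma j ^+ 2)) =
      32 / (l ^+ 2 * eps ^+ 2) * (sigma j ^+ 2)^-1.
    by field; rewrite !gt_eqF.
  have -> : q / j.+1%:R ^+ 2 =
      32 / (l ^+ 2 * eps ^+ 2) * ((kap * j.+1%:R) ^+ 2)^-1.
    by rewrite /q; field; rewrite !gt_eqF.
  rewrite ler_wpM2l//; first by apply: divr_ge0 => //; apply: mulr_ge0; exact: sqr_ge0.
  have kj0 : 0 < kap * j.+1%:R by rewrite mulr_gt0.
  rewrite lef_pV2 ?posrE ?exprn_gt0//.
  by rewrite ler_sqr ?nnegrE ?(ltW kj0) ?(ltW s0).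
have main : M%:R <= \sum_(j < N) edge_mass psi e j + M%:R * (q / N%:R).
  apply: (parseval_truncation (fun k j => ip (mode e k) (S j) ^+ 2)) => //.
  - move=> k; have := parseval _ psi S hbasis pS cS (edgewise_continuous_mode e k).
    by rewrite ip_mode_mode eqxx.
  - by move=> j; rewrite massE; exact: bessel_mode.
  - by rewrite -(ltr0n R).
have : M%:R * (q / N%:R) <= l / L * q.
  have -> : l / L * q = l / L * N%:R * (q / N%:R) by field; rewrite !gt_eqF.
  by rewrite ler_wpM2r// divr_ge0// ltW.
lra.
Qed.

End lower_bound.

(** * Averages *)

Section averages.
Context {R : realType}.

(** The known Cesaro theorem averages [n + 1] terms, hence the shift of the index. *)
Lemma cesaro_mean (u : nat -> R) (l : R) : u @ \oo --> l ->
  (N%:R^-1 * \sum_(j < N) u j) @[N --> \oo] --> l.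
Proof.
move=> /cesaro h; rewrite -(cvg_shiftS (fun N : nat => N%:R^-1 * \sum_(j < N) u j)).
apply: cvg_trans h; apply: near_eq_cvg; apply: nearW => n /=.
by rewrite /arithmetic_mean/= seriesEord.
Qed.

(* Since the total is fixed, lower bounds in all coordinates are sharp. *)
Lemma cvg_simplex (E : finType) (a : E -> nat -> R) (r : E -> R) :
  \sum_e r e = 1 -> (\forall n \near \oo, \sum_e a e n = 1) ->
  (forall e d, 0 < d -> \forall n \near \oo, r e - d <= a e n) ->
  forall e, a e n @[n --> \oo] --> r e.
Proof.
move=> r1 a1 lower e; apply/cvgrPdist_le => d d0.
have c0 : 0 < #|E|%:R :> R by rewrite ltr0n; apply/card_gt0P; exists e.
(* The other coordinates, fewer than [#|E|], fall short by at most [d'] each, so coordinate [e]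
   exceeds [r e] by at most [d]. *)
pose d' := d / #|E|%:R.
have d'0 : 0 < d' by rewrite divr_gt0.
have low : \forall n \near \oo, forall e', r e' - d' <= a e' n.
  by apply: filter_forall => e'; exact: lower.
near=> n.
have h : forall e', r e' - d' <= a e' n by near: n.
have a1n : \sum_e a e n = 1 by near: n.
have dd : d' <= d.
  by rewrite ler_pdivrMr// ler_peMr ?(ltW d0)// ler1n -(ltr0n R).
rewrite distrC ler_norml; apply/andP; split.
  by have := h e; move: dd; lra.
have : \sum_(e' | e' != e) (r e' - d') <= \sum_(e' | e' != e) a e' n.
  by apply: ler_sum => e' _; exact: h.
rewrite sumrB sumr_const.
move: r1 a1n; rewrite (bigD1 e)//= => r1; rewrite (bigD1 e)//= => a1n.
have : d' *+ #|[pred e' | e' != e]| <= d.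
  rewrite -mulr_natr /d' mulrAC ler_pdivrMr// ler_wpM2l ?(ltW d0)//.
  by rewrite ler_nat max_card.
move: r1 a1n => <- /eqP; rewrite eq_sym addrC -subr_eq => /eqP.
lra.
Unshelve. all: by end_near. Qed.

End averages.

(** * Averages of edge masses and comparison with amplitudes *)

Section edge_average.
Context {R : realType} {G : metricGraph R}.
Variables (psi : nat -> graph_fun G) (lambda sigma : nat -> R).
Hypothesis hbasis : orthonormal_basis psi.
Hypothesis heig : forall j, eigenfunction (lambda j) (psi j).
Hypothesis hsigma : forall j, 0 <= sigma j.
Hypothesis hlambda : forall j, lambda j = sigma j ^+ 2.
Hypothesis hord : forall i j : nat, (i <= j)%N -> lambda i <= lambda j.

Lemma edge_mass_average (e : edge G) :
  (N%:R^-1 * \sum_(j < N) edge_mass psi e j) @[N --> \oo] -->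
  len e / total_length G.
Proof.
have L0 := total_length_gt0 e.
apply: (cvg_simplex _ (fun e (N : nat) => N%:R^-1 * \sum_(j < N) edge_mass psi e j)
  (fun e => len e / total_length G)).
- by rewrite -mulr_suml divff// gt_eqF.
- near=> N; have N0 : (0 < N)%N by near: N; exact: nbhs_infty_gt.
  rewrite -mulr_sumr exchange_big/=.
  under eq_bigr do rewrite edge_mass_sum//.
  by rewrite sumr_const card_ord mulVf// pnatr_eq0 -lt0n.
(* Half of [d] pays for [eps], as [len e / L <= 1], and the other half absorbs [C / N]; the bound
   [1 / 2] keeps [eps] below 1. *)
- move=> {}e d d0; pose eps := Num.min (d / 2) 2^-1.
  have eps0 : 0 < eps by rewrite lt_min divr_gt0//= invr_gt0.
  have epsd : eps <= d / 2 by rewrite ge_min lexx.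
  have eps1 : eps < 1.
    by apply: (@le_lt_trans _ _ 2^-1); [rewrite ge_min lexx orbT|lra].
  have eps01 : 0 < eps < 1 by rewrite eps0.
  have [C [N0 hC]] := edge_mass_lower _ _ _ hbasis heig hsigma hlambda hord e eps eps01.
  near=> N.
  have N0N : (N0 <= N)%N by near: N; exact: nbhs_infty_ge.
  have Npos : 0 < N%:R :> R by rewrite ltr0n; near: N; exact: nbhs_infty_gt.
  have NC : 2 * C / d <= N%:R by near: N; exact: nbhs_infty_ger.
  have l0 := len_gt0 e.
  have lL : len e / total_length G <= 1 by rewrite ler_pdivrMr// mul1r len_le_total.
  have lL0 : 0 <= len e / total_length G by rewrite divr_ge0 ?ltW.
  have {}hC := hC N N0N.
  set y := len e / total_length G in lL lL0 hC *.
  rewrite mulrC ler_pdivlMr//; apply: le_trans hC.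
  move: NC; rewrite ler_pdivrMr// => NC.
  have h1 : eps * y * N%:R <= d / 2 * N%:R.
    rewrite ler_wpM2r ?(ltW Npos)//; apply: le_trans epsd.
    by rewrite ler_piMr// ltW.
  by lra.
Unshelve. all: by end_near. Qed.

Lemma sigma_pinfty (e : edge G) (c : R) : \forall j \near \oo, c <= sigma j.
Proof.
have L0 := total_length_gt0 e.
have k0 : 0 < pi / (2 * total_length G) by rewrite divr_gt0 ?pi_gt0// mulr_gt0.
near=> j.
have h1 : 4 * #|edge G|%:R <= j%:R :> R by near: j; exact: nbhs_infty_ger.
have h2 : c / (pi / (2 * total_length G)) <= j%:R by near: j; exact: nbhs_infty_ger.
have j1 : j%:R <= j.+1%:R :> R by rewrite ler_nat.
apply: le_trans (sigma_linear _ _ _ hbasis heig hsigma hlambda hord e j _).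
  by rewrite mulrC -ler_pdivrMr//; exact: le_trans j1.
exact: le_trans j1.
Unshelve. all: by end_near. Qed.

(** The difference is of order [b j ^ 2 / sigma j]; the unit norm eventually bounds [b j ^ 2] by
    [4 / len e], and [sigma j] tends to infinity. *)
Lemma amplitude_edge_mass (e : edge G) (b phi : nat -> R) :
  (forall (j : nat) (x : R), 0 <= x <= len e ->
    psi j e x = b j * cos (sigma j * x + phi j)) ->
  b j ^+ 2 - 2 / len e * edge_mass psi e j @[j --> \oo] --> (0 : R).
Proof.
move=> hpsi; have l0 := len_gt0 e.
apply/cvgrPdist_le => d d0; near=> j.
have s4 : 4 / len e <= sigma j by near: j; exact: sigma_pinfty.
(* The error is at most [(2 / len e) * (4 / len e) / sigma j], which this threshold brings below
   [d]. *)
have sd : 8 / (len e ^+ 2 * d) <= sigma j by near: j; exact: sigma_pinfty.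
have s0 : 0 < sigma j by apply: lt_le_trans s4; rewrite divr_gt0.
pose A := b j * cos (phi j); pose B := - (b j * sin (phi j)).
have massE : edge_mass psi e j = \int[@lebesgue_measure R]_(x in `[0, len e])
    (sinusoid A B (sigma j) x * sinusoid A B (sigma j) x).
  apply: eq_Rintegral => x; rewrite mem_setE in_itv/= => xe.
  by rewrite hpsi// cosD /sinusoid /A /B; congr (_ * _); ring.
have wE : b j ^+ 2 = A ^+ 2 + B ^+ 2.
  rewrite -[LHS]mulr1 -(cos2Dsin2 (phi j)) /A /B; ring.
have := Rintegral_sinusoid_sqr_approx A B (sigma j) (len e) (ltW l0) s0.
have := weight_le A B (sigma j) (len e) l0.
rewrite -massE -wE -ler_pdivrMr// => /(_ s4 (edge_mass_le1 _ hbasis e j)) w4 approx.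
rewrite sub0r normrN.
have -> : b j ^+ 2 - 2 / len e * edge_mass psi e j =
    - (2 / len e * (edge_mass psi e j - b j ^+ 2 * len e / 2)).
  by field; rewrite gt_eqF.
have l20 : 0 < 2 / len e by rewrite divr_gt0.
rewrite normrN normrM gtr0_norm//.
apply: (le_trans (ler_wpM2l (ltW l20) approx)).
apply: (@le_trans _ _ (2 / len e * (4 / len e / sigma j))).
  by rewrite ler_wpM2l ?(ltW l20)// ler_wpM2r// invr_ge0 ltW.
have -> : 2 / len e * (4 / len e / sigma j) = 8 / (len e ^+ 2 * d) * d / sigma j.
  by field; rewrite !gt_eqF.
by rewrite ler_pdivrMr// [leRHS]mulrC ler_wpM2r// ltW.
Unshelve. all: by end_near. Qed.

End edge_average.

Theorem mainTheorem5 (R : realType) (G : metricGraph R)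
  (hconn : connected_graph G)
  (psi : nat -> graph_fun G) (lambda sigma : nat -> R)
  (hbasis : orthonormal_basis psi)
  (heig : forall j, eigenfunction (lambda j) (psi j))
  (hsigma : forall j, 0 <= sigma j)
  (hlambda : forall j, lambda j = sigma j ^+ 2)
  (hord : forall i j : nat, (i <= j)%N -> lambda i <= lambda j)
  (e : edge G) (b phi : nat -> R)
  (hb : forall j, 0 <= b j)
  (hpsi : forall (j : nat) (x : R), 0 <= x <= len e ->
    psi j e x = b j * cos (sigma j * x + phi j)) :
  (N%:R^-1 * \sum_(j < N) b j ^+ 2) @[N --> \oo] --> 2 / total_length G.
Proof.
have l0 := len_gt0 e; have L0 := total_length_gt0 e.
have mass := edge_mass_average _ _ _ hbasis heig hsigma hlambda hord e.
have err := cesaro_mean _ _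
  (amplitude_edge_mass _ _ _ hbasis heig hsigma hlambda hord e b phi hpsi).
(* The average of [b j ^ 2] splits into that of the vanishing differences, with limit 0, and
   [2 / len e] times the average mass. *)
have -> : 2 / total_length G = 0 + 2 / len e * (len e / total_length G).
  by field; rewrite !gt_eqF.
have -> : (fun N : nat => N%:R^-1 * \sum_(j < N) b j ^+ 2) =
  (fun N : nat => N%:R^-1 * (\sum_(j < N) (b j ^+ 2 - 2 / len e * edge_mass psi e j)) +
     2 / len e * (N%:R^-1 * \sum_(j < N) edge_mass psi e j)).
  apply/funext => N; rewrite sumrB -mulr_sumr; ring.
by apply: cvgD => //; apply: cvgM => //; exact: cvg_cst.
Qed.
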